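(* Let $n\ge 1$, and let $Q(t)$ be the number in system at time $t$ in the FCFS $GI/GI/n$ queue $\mathcal{Q}$ with inter-arrival distribution $U$, processing time distribution $V$, and the initial conditions described in the context. Let $A(\cdot), N_1(\cdot),\ldots,N_n(\cdot)$ be the counting functions of independent equilibrium renewal processes described in the context. Then for all $t,x\ge 0$, $\mathbb{P}\big(Q(t)\ge x\big)$ is at most $$\inf_{\delta \in [0,t],\ \eta \in \{0,1,\ldots,n\}} \mathbb{P}\Bigg( \max \bigg(\sup_{0 \leq s \leq \delta} \Big( A(s) - \sum_{i=1}^{\eta} N_i(s) \Big),\ \sup_{\delta \leq s \leq t} \Big( A(s) - \sum_{i=1}^n N_i(s) \Big) + \sum_{i = \eta + 1}^n N_i(\delta) \bigg) + \sum_{i = \eta + 1}^n I\big(N_i(\delta) = 0\big) \geq x -\eta\Bigg).$$ If in addition $Q(t)$ converges weakly to a steady-state distribution $Q(\infty)$ as $t\to\infty$, then for all $x\ge 0$, $\mathbb{P}\big(Q(\infty)\ge x\big)$ is at most $$\inf_{\delta \geq 0,\ \eta \in \{0,1,\ldots,n\}} \mathbb{P}\Bigg( \max \bigg(\sup_{0 \leq t \leq \delta} \Big( A(t) - \sum_{i=1}^{\eta} N_i(t) \Big),\ \sup_{t \geq \delta} \Big( A(t) - \sum_{i=1}^n N_i(t) \Big) + \sum_{i = \eta + 1}^n N_i(\delta) \bigg) + \sum_{i = \eta + 1}^n I\big(N_i(\delta) = 0\big) \geq x -\eta\Bigg).$$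
   Context: $U$ and $V$ are non-negative random variables with finite mean and $\mathbb{P}(U=0)=\mathbb{P}(V=0)=0$. For a non-negative random variable $X$ with finite mean $\mathbb{E}[X]>0$, the residual life distribution $R(X)$ is defined by $\mathbb{P}(R(X)>z) = (\mathbb{E}[X])^{-1}\int_z^\infty \mathbb{P}(X>y)\,dy$, $z\ge 0$. An equilibrium renewal process with renewal distribution $X$ is a counting process whose first inter-event time is distributed as $R(X)$ and whose subsequent inter-event times are i.i.d. distributed as $X$ (all inter-event times independent). $\mathcal{N}_1,\ldots,\mathcal{N}_n$ are i.i.d. equilibrium renewal processes with renewal distribution $V$, and $\mathcal{A}$ is an independent equilibrium renewal process with renewal distribution $U$. $N_i(t)$ and $A(t)$ denote the number of renewals in $[0,t]$ of $\mathcal{N}_i$ and $\mathcal{A}$ respectively (right-continuous with left limits). $I(\cdot)$ is the indicator function. Empty sums are zero. $\mathcal{Q}$ is the first-come-first-serve queue with $n$ parallel servers and unlimited waiting room, i.i.d. inter-arrival times distributed as $U$, and i.i.d. processing times distributed as $V$, independent of the arrivals, with the following initial conditions at time $0$: each server $i\in\{1,\ldots,n\}$ holds exactly one job, the initial remaining processing times being independent and distributed as $R(V)$; the time until the first arrival is distributed as $R(U)$ (independently of everything else); and there are zero jobs waiting in queue. $Q(t)$ is the total number in system (in service plus waiting) at time $t$. *)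

(* Defs.v *)
From HB Require Import structures.
From mathcomp Require Export all_boot all_order all_algebra.
From mathcomp Require Export all_classical all_reals all_analysis.
Export Order.TTheory GRing.Theory Num.Theory.
Export numFieldNormedType.Exports.

#[export] Set Implicit Arguments.
#[export] Unset Strict Implicit.
#[export] Unset Printing Implicit Defensive.

Local Open Scope classical_set_scope.
Local Open Scope ring_scope.

Section laws.
Context (R : realType).

Definition same_law d d' (T : measurableType d) (T' : measurableType d')
    (P : probability T R) (P' : probability T' R)
    (X : {RV P >-> R}) (Y : {RV P' >-> R}) : Prop :=
  forall B : set R, measurable B -> distribution P X B = distribution P' Y B.

(* [Y] is distributed as the residual life [R(X)]; taking [z = 0] forces
   [Y > 0] almost surely, so the tail on [z >= 0] determines the law. *)
Definition residual_life d d' (T : measurableType d) (T' : measurableType d')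
    (P : probability T R) (P' : probability T' R)
    (X : {RV P >-> R}) (Y : {RV P' >-> R}) : Prop :=
  forall z : R, 0 <= z ->
    (ccdf Y z = ((fine 'E_P[X])^-1)%:E *
                \int[lebesgue_measure]_(y in `]z, +oo[) ccdf X y)%E.

Definition mutually_independent d (T : measurableType d) (P : probability T R)
    (I : eqType) (X : I -> {RV P >-> R}) : Prop :=
  forall (s : seq I) (B : I -> set R), uniq s ->
    (forall i, measurable (B i)) ->
    (P [set w | forall i, i \in s -> B i (X i w)] =
     \prod_(i <- s) P (X i @^-1` B i))%E.

Definition weakly_converges d (T : measurableType d) (P : probability T R)
    (Y : R -> T -> R) (mu : probability R R) : Prop :=
  forall f : R -> R, continuous f -> (exists M : R, forall x, `|f x| <= M) ->
    (\int[P]_w (f (Y t w))%:E)%E @[t --> +oo] --> (\int[mu]_x (f x)%:E)%E.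

End laws.

Section renewal.
Context (R : realType).

Definition event_time (x : nat -> R) (k : nat) : R := \sum_(j < k.+1) x j.

(* Counts the events in [0, t]; extended-real valued because on a null set
   infinitely many events may fall in a bounded interval. *)
Definition renewals (x : nat -> R) (t : R) : \bar R :=
  (\sum_(0 <= k <oo) ((0 <= event_time x k <= t)%R : nat)%:R%:E)%E.

(* The marginal laws of the inter-event times of an equilibrium renewal
   process with renewal distribution [X]. *)
Definition equilibrium_laws d d' (T : measurableType d)
    (T' : measurableType d') (P : probability T R) (P' : probability T' R)
    (X : {RV P >-> R}) (x : nat -> {RV P' >-> R}) : Prop :=
  residual_life X (x 0%N) /\ forall k, same_law X (x k.+1).

(* Independent equilibrium renewal processes: one with inter-event times [u]
   and renewal distribution [U], and [n] with inter-event times [v i] and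
   renewal distribution [V].  The index [None] stands for the former. *)
Definition independent_equilibrium_renewals d d' (T : measurableType d)
    (T' : measurableType d') (P : probability T R) (P' : probability T' R)
    (U V : {RV P >-> R}) (n : nat)
    (u : nat -> {RV P' >-> R}) (v : 'I_n -> nat -> {RV P' >-> R}) : Prop :=
  [/\ equilibrium_laws U u,
      forall i, equilibrium_laws V (v i) &
      mutually_independent (fun j : option 'I_n * nat =>
        if j.1 is Some i then v i j.2 else u j.2)].

End renewal.

Section queue.
Context (R : realType) (n : nat).

(* A sample path of the queue is driven by the inter-arrival times [a] (the
   first arrival occurs at time [a 0]), the remaining processing times [r] of
   the jobs initially in service, and the processing times [p], where [p k] is
   that of the [k]-th arriving job. *)
Context (a : nat -> R) (r : 'I_n -> R) (p : nat -> R).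

Definition first_free (W : 'I_n -> R) : option 'I_n :=
  [pick i | [forall j, W i <= W j]].

(* Jobs enter service in order of arrival, so a job arriving at time [s] when
   the servers finish all earlier jobs at times [W] goes to the server that is
   free first.  The [None] case only occurs for [n = 0]. *)
Definition start_time (W : 'I_n -> R) (s : R) : R :=
  if first_free W is Some i then Num.max s (W i) else s.

(* [free_times k i] is the time at which server [i] has finished its initial
   job and those of the arriving jobs [0, ..., k - 1] assigned to it. *)
Fixpoint free_times (k : nat) : 'I_n -> R :=
  if k is k'.+1 then
    let W := free_times k' in
    fun i => if first_free W == Some i
             then start_time W (event_time a k') + p k' else W i
  else r.

Definition departure_time (k : nat) : R :=
  start_time (free_times k) (event_time a k) + p k.

(* Initial jobs still present at time [t], plus jobs that have arrived and not
   departed.  The series is almost surely finite. *)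
Definition number_in_system (t : R) : R :=
  \sum_(i < n) ((t < r i)%R : nat)%:R +
  fine (\sum_(0 <= k <oo)
          ((event_time a k <= t < departure_time k)%R : nat)%:R%:E)%E.

End queue.

(* The primitives of the FCFS GI/GI/n queue: equilibrium arrival stream, initial
   remaining processing times distributed as [R(V)], i.i.d. processing times. *)
Definition GI_GI_n_primitives (R : realType) d d' (T : measurableType d)
    (T' : measurableType d') (P : probability T R) (P' : probability T' R)
    (U V : {RV P >-> R}) (n : nat) (a : nat -> {RV P' >-> R})
    (r : 'I_n -> {RV P' >-> R}) (p : nat -> {RV P' >-> R}) : Prop :=
  [/\ equilibrium_laws U a,
      forall i, residual_life V (r i),
      forall k, same_law V (p k) &
      mutually_independent (fun j : nat + 'I_n + nat =>
        match j with
        | inl (inl k) => a k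
        | inl (inr i) => r i
        | inr k => p k
        end)].

(* Main.v *)
From HB Require Import structures.
Require Import Defs.
From mathcomp Require Import all_boot all_order all_algebra all_fingroup.
From mathcomp Require Import all_classical all_reals all_analysis.
From mathcomp Require Import measurable_realfun zify lra.
Import Order.TTheory GRing.Theory Num.Theory.

Local Open Scope classical_set_scope.
Local Open Scope ring_scope.
Local Open Scope ereal_scope.

(** Drive the servers by the renewal processes [v] of the bound.  In this busy
    system a server never rests: when a job ends at an event of its own process
    it takes the next waiting customer, or a placeholder if no customer waits,
    and the new job lasts until the next event.  The service completions are
    then renewal events whatever the arrivals are.  In addition the servers of
    rank at least [eta], called late, refuse customers during the last [delta]
    units of time before [t].

    Recording the durations of the jobs given to customers couples the busy
    system with the queue.  The duration that a customer receives has never been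
    looked at before it enters service, so the recorded times are i.i.d. with
    the law of [V] ([recorded_iid]) and the queue fed with them has the
    prescribed law ([queue_input_law]).  Placeholders and blocking only delay
    customers ([free_times_le_clock]), hence the busy system has at least as
    many customers at time [t] as the queue.  It is easy to bound: the early
    servers hold at most [eta] customers, a late server holds one only if it
    completed no job during the last [delta] units of time, and the waiting line
    is, by the Lindley recursion ([served_lindley]), at most the excess of
    arrivals over usable completions since some instant [t - s].  This gives the
    stated bound for the renewal processes counted backward from [t]
    ([number_in_system_le]).

    An equilibrium renewal process observed on [0, t] is invariant under time
    reversal, so one may count forward from [0] instead.  Indeed its first gap
    is a uniform point below a length-biased life ([palm]); with [k] events in
    the window the process amounts to a Lebesgue point and an i.i.d. sequence of
    lives, and reversal amounts to reflecting the point and reading the lives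
    backwards ([reversal_straddle]).

    The suprema run over a continuum, but the excess increases only at arrivals
    ([sup_at_events]), which makes the events measurable.  The steady-state
    bound follows since enlarging the window to an infinite one increases the
    right-hand side, which then no longer depends on [t], and the integer-valued
    process [Q] has tails that pass to the weak limit ([weak_limit_tail]). *)

(** * Random families of real numbers *)

Section pathspace.
Context {R : realType}.

Definition coordinate_events (I : Type) : set (set (I -> R)) :=
  [set A | exists i B, measurable B /\ A = (fun f => f i) @^-1` B].

Definition pathspace (I : Type) := g_sigma_algebraType (@coordinate_events I).

HB.instance Definition _ I := Measurable.on (pathspace I).

Definition cylinder (I : eqType) (l : seq I) (B : I -> set R) :
    set (pathspace I) :=
  [set f | forall i, i \in l -> B i (f i)].

Lemma measurable_coord (I : Type) (i : I) :
  measurable_fun [set: pathspace I] (fun f : pathspace I => f i : R).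
Proof.
move=> _ B mB; rewrite setTI; apply: sub_sigma_algebra.
by exists i, B.
Qed.

Lemma measurable_pathspace d (T : measurableType d) (I : Type)
    (f : T -> pathspace I) :
  (forall i, measurable_fun setT (fun w => f w i : R)) -> measurable_fun setT f.
Proof.
move=> mf _ A mA; rewrite setTI; move: A mA.
apply: (@smallest_sub _ _ _ [set A | measurable (f @^-1` A)]).
  split => [|A|F]/=; first exact: measurable0.
    by move=> mA; rewrite setTD preimage_setC; exact: measurableC.
  by move=> mF; rewrite preimage_bigcup; exact: bigcupT_measurable.
move=> _ [i [B [mB ->]]] /=.
by have := mf i measurableT B mB; rewrite setTI.
Qed.

Lemma measurable_cylinder (I : eqType) (l : seq I) (B : I -> set R) :
  (forall i, measurable (B i)) -> measurable (cylinder l B).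
Proof.
move=> mB; elim: l => [|i l IH].
  rewrite (_ : cylinder _ _ = setT); first exact: measurableT.
  by apply/seteqP; split.
rewrite (_ : cylinder _ _ =
  (fun f : pathspace I => f i) @^-1` (B i) `&` cylinder l B).
  apply: measurableI => //.
  by have := @measurable_coord I i measurableT _ (mB i); rewrite setTI.
apply/seteqP; split => [f Bf|f [Bi Bl] j].
  split; first by apply: Bf; rewrite mem_head.
  by move=> j jl; apply: Bf; rewrite inE jl orbT.
by rewrite inE => /predU1P[->|/Bl].
Qed.

(** Cylinders form a pi-system that generates the sigma-algebra, so the
    uniqueness theorem for finite measures applies to them. *)
Lemma eq_measure_pathspace (I : eqType)
    (m1 m2 : {measure set (pathspace I) -> \bar R}) :
  m1 setT < +oo ->
  (forall (l : seq I) (B : I -> set R), uniq l -> (forall i, measurable (B i)) ->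
    m1 (cylinder l B) = m2 (cylinder l B)) ->
  forall A, measurable A -> m1 A = m2 A.
Proof.
move=> m1T m12 A mA.
pose G : set (set (pathspace I)) := [set A | exists l B,
  (forall i : I, measurable (B i)) /\ A = cylinder l B].
apply: (g_sigma_algebra_measure_unique G _ (fun=> setT)) => //.
- by move=> _ [l [B [mB ->]]]; exact: measurable_cylinder.
- move=> _; exists [::], (fun=> setT); split => //.
  by apply/seteqP; split.
- by apply/seteqP; split => // f _; exists 0%N.
- move=> _ _ [l [B [mB ->]]] [l' [B' [mB' ->]]].
  exists (l ++ l'), (fun i => (if i \in l then B i else setT) `&`
                             (if i \in l' then B' i else setT)); split.
    by move=> i; apply: measurableI; case: ifP.
  apply/seteqP; split => [f [Bf Bf'] i _|f Bf].
    by split; case: ifPn => // il; [exact: Bf|exact: Bf'].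
  split=> i il; have := Bf i; rewrite mem_cat il ?orbT => /(_ isT) [].
    by [].
  by [].
- move=> _ [l [B [mB ->]]].
  have -> : cylinder l B = cylinder (undup l) B.
    by apply/seteqP; split => f Bf i il; apply: Bf; move: il; rewrite mem_undup.
  by apply: m12 => //; exact: undup_uniq.
have sub : coordinate_events (I:=I) `<=` G.
  move=> _ [i [B [mB ->]]]; exists [:: i], (fun=> B); split => //.
  by apply/seteqP; split => f Bf; [move=> j /[!inE] /eqP ->|apply/Bf/mem_head].
exact: (sub_sigma_algebra2 sub).
Qed.

End pathspace.
Arguments pathspace : clear implicits.
Arguments measurable_coord {R I} i.

(** With measurability as an argument, functions that are only locally known to
    be measurable push measures forward as well. *)
Definition image_measure d d' (T : measurableType d) (T' : measurableType d')
    (R : realFieldType) (m : {measure set T -> \bar R}) (f : T -> T')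
    (mf : measurable_fun setT f) : {measure set T' -> \bar R} :=
  measure_function_pushforward__canonical__measure_function_Measure m mf.

Section law_comparison.
Context {R : realType} d d' (T : measurableType d) (T' : measurableType d').

(** Comparison on cylinders is stated with side events and a factor so that it
    covers equality of two laws, independence from an event and a law known up
    to normalisation. *)
Lemma eq_law_pathspace (I : eqType) (P : {measure set T -> \bar R})
    (P' : {measure set T' -> \bar R}) (f : T -> pathspace R I)
    (f' : T' -> pathspace R I) (E : set T) (E' : set T') (c : R) :
  (0 <= c)%R ->
  measurable_fun setT f -> measurable_fun setT f' -> measurable E ->
  measurable E' -> P E < +oo ->
  (forall (l : seq I) (B : I -> set R), uniq l -> (forall i, measurable (B i)) ->
    P (E `&` f @^-1` cylinder l B) =
    c%:E * P' (E' `&` f' @^-1` cylinder l B)) ->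
  forall A, measurable A -> P (E `&` f @^-1` A) = c%:E * P' (E' `&` f' @^-1` A).
Proof.
move=> c0 mf mf' mE mE' PE PP' A mA.
pose m1 := image_measure (mrestr P mE) mf.
pose m2 := mscale (NngNum c0)
  (image_measure (mrestr P' mE') mf').
have m1E X : m1 X = P (E `&` f @^-1` X).
  by rewrite /m1 /= /pushforward /mrestr setIC.
have m2E X : m2 X = c%:E * P' (E' `&` f' @^-1` X).
  by rewrite /m2 /= /mscale /= /pushforward /mrestr setIC.
rewrite -m1E -m2E; apply: eq_measure_pathspace => //.
  by rewrite m1E preimage_setT setIT.
by move=> l B ul mB; rewrite m1E PP'//; exact/esym/m2E.
Qed.

End law_comparison.

Section families.
Context {R : realType}.

Definition joint d (T : measurableType d) (P : probability T R) (I : Type)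
    (X : I -> {RV P >-> R}) (w : T) : pathspace R I := fun i => X i w.

Lemma measurable_joint d (T : measurableType d) (P : probability T R)
    (I : Type) (X : I -> {RV P >-> R}) : measurable_fun setT (joint X).
Proof. by apply: measurable_pathspace => i; exact: measurable_funP. Qed.

Lemma measurable_preimageT d d' (T : measurableType d) (T' : measurableType d')
    (f : T -> T') (A : set T') :
  measurable_fun setT f -> measurable A -> measurable (f @^-1` A).
Proof. by move=> mf mA; rewrite -[X in measurable X]setTI; exact: mf. Qed.

Lemma eq_law_independent d d' (T : measurableType d) (T' : measurableType d')
    (P : probability T R) (P' : probability T' R) (I : eqType)
    (X : I -> {RV P >-> R}) (Y : I -> {RV P' >-> R}) :
  mutually_independent X -> mutually_independent Y ->
  (forall i, same_law (X i) (Y i)) ->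
  forall A, measurable A -> P (joint X @^-1` A) = P' (joint Y @^-1` A).
Proof.
move=> iX iY XY A mA.
have := @eq_law_pathspace R _ _ _ _ I P P' (joint X) (joint Y) setT setT 1 ler01.
have PT : P setT < +oo by rewrite probability_setT ltry.
move=> /(_ (measurable_joint _) (measurable_joint _) measurableT measurableT PT).
move=> XYE.
have H : forall (l : seq I) (B : I -> set R), uniq l ->
    (forall i, measurable (B i)) ->
    P ([set: T] `&` joint X @^-1` cylinder l B) =
    1 * P' ([set: T'] `&` joint Y @^-1` cylinder l B).
  move=> l B ul mB; rewrite mul1e !setTI.
  rewrite [LHS](iX l B ul mB) [RHS](iY l B ul mB).
  by apply: eq_bigr => i _; exact: XY.
by have := XYE H A mA; rewrite !setTI mul1e.
Qed.

(** Membership in [D] does not depend on coordinate [j].  Stated on points, so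
    that it can be read off from the way [D] is computed. *)
Definition insensitive (I : eqType) (j : I) (D : set (pathspace R I)) :=
  forall f g, (forall i, i != j -> f i = g i) -> D f -> D g.

Lemma independent_insensitive d (T : measurableType d) (P : probability T R)
    (I : eqType) (X : I -> {RV P >-> R}) (j : I) (D : set (pathspace R I))
    (B : set R) :
  mutually_independent X -> measurable D -> insensitive j D -> measurable B ->
  P (joint X @^-1` D `&` X j @^-1` B) = P (joint X @^-1` D) * P (X j @^-1` B).
Proof.
move=> iX mD iD mB.
(* Erasing coordinate [j] leaves [D] unchanged and turns it into an event about
   the other coordinates, whose cylinders are independent of [X j]. *)
pose upd (f : pathspace R I) : pathspace R I := fun i => if i == j then 0%R else f i.
have mupd : measurable_fun setT upd.
  apply: measurable_pathspace => i; rewrite /upd; case: eqP => _.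
    exact: measurable_cst.
  exact: measurable_coord.
have DE : joint X @^-1` D = (upd \o joint X) @^-1` D.
  apply/seteqP; split => w; apply: iD => i /negPf ij; by rewrite /upd/= ij.
have PXB : P (X j @^-1` B) \is a fin_num.
  by rewrite fin_num_measure//; exact: measurable_preimageT.
have PXB0 : (0 <= fine (P (X j @^-1` B)))%R by rewrite fine_ge0.
have := @eq_law_pathspace R _ _ _ _ I P P (upd \o joint X) (upd \o joint X)
  (X j @^-1` B) setT _ PXB0.
rewrite fineK//.
have mc : measurable_fun setT (upd \o joint X).
  by apply: measurableT_comp => //; exact: measurable_joint.
move=> /(_ mc mc (measurable_preimageT (measurable_funP (X j)) mB) measurableT).
rewrite ltey_eq PXB => /(_ isT) H.
rewrite DE setIC H//; first by rewrite setTI muleC.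
move=> l C ul mC; rewrite setTI.
have E0 : (upd \o joint X) @^-1` cylinder l C = joint X @^-1` cylinder [seq i <- l | i != j] C `&` [set _ | j \in l -> C j 0%R].
  apply/seteqP; split => [w h|w [h h']].
    split.
      move=> i; rewrite mem_filter => /andP[ij il]; have := h i il.
      by rewrite /upd/= (negPf ij).
    by move=> jl; have := h j jl; rewrite /upd/= eqxx.
  move=> i il; rewrite /upd/=; case: (eqVneq i j) => [ij|ij].
    by rewrite ij in il *; exact: h'.
  by apply: h; rewrite mem_filter ij.
have [C0|C0] := pselect (j \in l -> C j 0%R); last first.
  rewrite E0 (_ : [set _ | _] = set0) ?setI0 ?measure0 ?mule0//.
  by apply/seteqP; split.
have {}E0 : (upd \o joint X) @^-1` cylinder l C =
    joint X @^-1` cylinder [seq i <- l | i != j] C.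
  by rewrite E0 (_ : [set _ | _] = setT) ?setIT//; apply/seteqP; split.
rewrite E0.
pose l' := [seq i <- l | i != j].
have jl' : j \notin l' by rewrite mem_filter eqxx.
pose C'' i := if i == j then B else C i.
have mC'' i : measurable (C'' i) by rewrite /C''; case: ifP.
have -> : X j @^-1` B `&` joint X @^-1` cylinder l' C =
    [set w | forall i, i \in j :: l' -> C'' i (X i w)].
  apply/seteqP; split => [w [Bw Cw] i|w h].
    rewrite inE => /predU1P[->|il]; first by rewrite /C'' eqxx.
    rewrite /C''; case: eqP => [ij|_]; last exact: Cw.
    by move: il; rewrite ij (negPf jl').
  split; first by have := h j (mem_head _ _); rewrite /C'' eqxx.
  move=> i il; have := h i; rewrite inE il orbT /C'' => /(_ isT).
  by case: eqP => // ij; move: il; rewrite ij (negPf jl').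
have ujl' : uniq (j :: l') by rewrite /= jl' filter_uniq.
rewrite [LHS](iX _ _ ujl' mC'') big_cons /C'' eqxx; congr (_ * _).
rewrite [RHS](iX l' C (filter_uniq _ ul) mC); apply: eq_big_seq => i il.
by case: eqP => // ij; move: il; rewrite ij (negPf jl').
Qed.

End families.

Local Close Scope ereal_scope.

(** * The system with permanently busy servers *)

Section first_free.
Context {R : realType} {n : nat}.

Lemma first_free_Some (W : 'I_n -> R) i :
  first_free W = Some i -> forall j, W i <= W j.
Proof.
by rewrite /first_free; case: pickP => // k /forallP h [<-] j; exact: h.
Qed.

Lemma first_free_ex (W : 'I_n -> R) : (0 < n)%N -> exists i, first_free W = Some i.
Proof.
move=> n0; rewrite /first_free; case: pickP => [i _|h]; first by exists i.
pose i0 : 'I_n := Ordinal n0.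
have := h (Order.arg_min i0 xpredT W).
case: Order.TotalTheory.arg_minP => // i _ mini /negbT/forallPn[j].
by rewrite mini.
Qed.

End first_free.

Section event_times.
Context {R : realType}.

Lemma event_timeS (x : nat -> R) k : event_time x k.+1 = event_time x k + x k.+1.
Proof. by rewrite /event_time big_ord_recr. Qed.

Lemma event_time0 (x : nat -> R) : event_time x 0 = x 0%N.
Proof. by rewrite /event_time big_ord_recl big_ord0 addr0. Qed.

Lemma le_event_time (x : nat -> R) : (forall k, 0 <= x k) ->
  {homo event_time x : j k / (j <= k)%N >-> j <= k}.
Proof.
move=> x0; apply: homo_leq; [exact: lexx|exact: le_trans|].
by move=> k; rewrite event_timeS lerDl.
Qed.

End event_times.

Section busy_system.
Context {R : realType} {n : nat}.

(** Between two of its service completions a server holds one job, either a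
    customer or a placeholder.  [job i] is the rank of the job held by server
    [i], [real i] tells whether it is a customer, [served] counts the customers
    that entered service and [proc] records their processing times. *)
Record state := State {
  job : 'I_n -> nat;
  real : 'I_n -> bool;
  served : nat;
  proc : nat -> R }.

Variable blocked : 'I_n -> R -> bool.

Section step.
Variables (u : nat -> R) (v : 'I_n -> nat -> R).

Definition clock (st : state) (i : 'I_n) : R := event_time (v i) (job st i).

Definition admits (st : state) (i : 'I_n) : bool :=
  (event_time u (served st) <= clock st i) && ~~ blocked i (clock st i).

(** One step deals with the earliest pending completion: the server takes the
    next customer if that customer has arrived and the server is not blocked,
    and a placeholder otherwise.  In both cases the duration of the new job is
    the next entry of the server's own sequence. *)
Definition step (st : state) : state :=
  if first_free (clock st) is Some i then
    State (fun j => if j == i then (job st j).+1 else job st j)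
          (fun j => if j == i then admits st i else real st j)
          (admits st i + served st)
          (fun k => if admits st i && (k == served st)
                    then v i (job st i).+1 else proc st k)
  else st.

Definition run (l : nat) : state :=
  iter l step (State (fun=> 0%N) (fun=> true) 0%N (fun=> 0)).

Lemma runS l : run l.+1 = step (run l). Proof. by []. Qed.

Definition next_time (l : nat) : R :=
  if first_free (clock (run l)) is Some i then clock (run l) i else 0.

Hypothesis n_gt0 : (0 < n)%N.
Hypothesis v_ge0 : forall i k, 0 <= v i k.

Lemma run_past l i m : (m < job (run l) i)%N ->
  forall i', event_time (v i) m <= clock (run l) i'.
Proof.
elim: l => [//|l IH] in i m *; rewrite runS /step.
have [i0 i0E] := first_free_ex (clock (run l)) n_gt0.
have i0min := first_free_Some i0E.
rewrite i0E /clock /= => mi i'.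
have le1 : event_time (v i) m <= clock (run l) i'.
  move: mi; case: eqP => [ii0|_]; last by move=> /IH.
  rewrite ltnS leq_eqVlt => /orP[/eqP ->|/IH//].
  by rewrite ii0; exact: i0min.
apply: (le_trans le1); rewrite /clock; case: eqP => // ->.
exact: le_event_time.
Qed.

Lemma run_served_le l l' : (l <= l')%N -> (served (run l) <= served (run l'))%N.
Proof.
elim: l' => [|l' IH]; first by rewrite leqn0 => /eqP ->.
rewrite leq_eqVlt => /predU1P[->//|/IH/leq_trans]; apply.
by rewrite runS /step; case: first_free => //= i; exact: leq_addl.
Qed.

Lemma run_job_le l l' i : (l <= l')%N -> (job (run l) i <= job (run l') i)%N.
Proof.
elim: l' => [|l' IH]; first by rewrite leqn0 => /eqP ->.
rewrite leq_eqVlt => /predU1P[->//|/IH/leq_trans]; apply.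
by rewrite runS /step; case: first_free => //= j; case: ifP.
Qed.

Lemma run_proc_stable l l' k : (l <= l')%N -> (k < served (run l))%N ->
  proc (run l') k = proc (run l) k.
Proof.
move=> ll' kl; elim: l' ll' => [|l' IH]; first by rewrite leqn0 => /eqP ->.
rewrite leq_eqVlt => /predU1P[->//|]; rewrite ltnS => ll'.
rewrite runS -IH// /step; case: first_free => //= i.
case: ifP => // /andP[_ /eqP kE].
by have := run_served_le ll'; rewrite -kE leqNgt kl.
Qed.

Lemma run_proc_default l k : (served (run l) <= k)%N -> proc (run l) k = 0.
Proof.
elim: l => [//|l IH]; rewrite runS /step; case: first_free => //= i.
case: ifP => [/andP[-> /eqP ->]|]; first by rewrite ltnn.
move=> _ h; apply: IH; apply: leq_trans h; exact: leq_addl.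
Qed.

Lemma sum_job l : (\sum_i job (run l) i)%N = l.
Proof.
elim: l => [|l IH]; first by rewrite big1.
rewrite runS /step; have [i0 ->] := first_free_ex (clock (run l)) n_gt0.
rewrite /= (bigD1 i0)//= eqxx addSn; congr S.
rewrite -[RHS]IH [RHS](bigD1 i0)//=; congr (_ + _)%N.
by apply: eq_bigr => i /negPf ->.
Qed.

(** A server starts its next job only when an earlier one ends, so all epochs
    below the current rank have been processed. *)
Lemma run_job_late b l i m : (forall j, (j < l)%N -> next_time j <= b) ->
  (m < job (run l) i)%N -> event_time (v i) m <= b.
Proof.
elim: l => [//|l IH] le_t.
have := le_t l (leqnn _); rewrite runS /step /next_time.
have [i0 i0E] := first_free_ex (clock (run l)) n_gt0.
rewrite i0E /= => i0t; have {}IH := IH (fun j jl => le_t j (leqW jl)).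
case: eqP => // ii0; rewrite ltnS leq_eqVlt => /predU1P[->|//].
by rewrite ii0.
Qed.

(** Each step uses up one job of some server ([sum_job]), and each server has
    only finitely many completions up to [b]. *)
Lemma run_passes b : (forall i M, exists k, M < event_time (v i) k) ->
  exists2 l, forall j, (j < l)%N -> next_time j <= b &
  forall i, b < clock (run l) i.
Proof.
move=> v_unbounded.
have [m mP] : {m : 'I_n -> nat | forall i, b < event_time (v i) (m i)}.
  by exists (fun i => projT1 (cid (v_unbounded i b))) => i; case: cid.
have : exists l, b < next_time l.
  apply: contrapT => /forallNP le_t.
  have {}le_t l : next_time l <= b by rewrite leNgt; exact/negP.
  have : (\sum_i job (run (\sum_i m i).+1) i <= \sum_i m i)%N.
    apply: leq_sum => i _; rewrite leqNgt; apply/negP => h.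
    by have := run_job_late (fun j _ => le_t j) h; rewrite leNgt mP.
  by rewrite sum_job// ltnn.
move=> /ex_minnP[l lP lmin]; exists l => [j|i].
  by rewrite leNgt; apply: contraL => /lmin; rewrite -leqNgt.
move: lP; rewrite /next_time.
have [i0 i0E] := first_free_ex (clock (run l)) n_gt0.
by rewrite i0E => /lt_le_trans; apply; exact: first_free_Some.
Qed.

End step.

Section comparison.
Variables (u : nat -> R) (v : 'I_n -> nat -> R) (p : nat -> R).
Hypothesis n_gt0 : (0 < n)%N.
Hypothesis v_ge0 : forall i k, 0 <= v i k.
(* The coupling: a customer has the same processing time in both systems. *)
Hypothesis run_p : forall l k, (k < served (run u v l))%N ->
  proc (run u v l) k = p k.

Notation run := (run u v).
Notation W := (free_times u (fun i => v i 0%N) p).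
Notation D := (departure_time u (fun i => v i 0%N) p).
Notation next := (next_time u v).

(** Placeholders only delay customers: up to a permutation of the servers,
    every server of the ordinary queue is free no later than in the busy
    system.  Replacing the smallest entry of each vector preserves this. *)
Lemma free_times_le_clock l : exists s : {perm 'I_n},
  forall i, W (served (run l)) (s i) <= clock v (run l) i.
Proof.
elim: l => [|l [s IH]].
  by exists 1%g => i; rewrite perm1 /= /clock /= event_time0.
have := run_p (l := l.+1); rewrite runS /step.
have [i0 i0E] := first_free_ex (clock v (run l)) n_gt0.
have i0min := first_free_Some i0E.
rewrite i0E /=; case: (boolP (admits u v (run l) i0)) => [adm|_] pE; last first.
  exists s => i; apply: (le_trans (IH i)); rewrite /clock /=.
  by case: eqP => // ->; exact: le_event_time.
set k := served (run l).
have {}pE : v i0 (job (run l) i0).+1 = p k.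
  by have := pE k; rewrite ltnS leqnn eqxx => /(_ isT).
have [j0 j0E] := first_free_ex (W k) n_gt0.
have j0min := first_free_Some j0E.
have i0le : W k j0 <= clock v (run l) i0 by exact: le_trans (j0min (s i0)) (IH i0).
(* Server [i0] is now matched with [j0], the one that serves customer [k] in the
   ordinary queue, and the former partner of [j0] with that of [i0]. *)
exists (tperm i0 (s^-1 j0) * s)%g => i.
have startle : start_time (W k) (event_time u k) + p k <=
    event_time (v i0) (job (run l) i0).+1.
  rewrite event_timeS pE lerD2r /start_time j0E ge_max i0le andbT.
  by case/andP: adm.
rewrite permM add1n /= j0E (inj_eq Some_inj) /clock /=.
case: tpermP => [->|iE|/eqP ii0 /eqP ij0].
- by rewrite permKV !eqxx.
- rewrite iE; case: (eqVneq (s^-1 j0)%g i0) => [e|ne].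
    have -> : s i0 = j0 by rewrite -e permKV.
    by rewrite eqxx e.
  rewrite ifN; last by apply: contra ne => /eqP ->; rewrite permK.
  exact: le_trans (IH i0) (i0min _).
- rewrite (negPf ii0) ifN; first exact: IH.
  by apply: contra ij0 => /eqP ->; rewrite permK.
Qed.

Section window.
Variable t : R.

(** Up to time [t], every job present in the ordinary queue and already served
    by the busy system is matched with a server still holding a customer. *)
Lemma present_le_real l : (forall j, (j < l)%N -> next j <= t) ->
  (\sum_(i < n) (t < v i 0)%R + \sum_(k < served (run l)) (t < D k)%R <=
   \sum_(i < n) (real (run l) i && (t < clock v (run l) i)%R))%N.
Proof.
elim: l => [|l IH] le_t.
  rewrite big_ord0 addn0 leq_sum// => i _ /=.
  by rewrite /clock/= event_time0.
have {}IH := IH (fun j jl => le_t j (leqW jl)).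
have := le_t l (leqnn _); rewrite /next_time.
have [s sP] := free_times_le_clock l.
have := run_p (l := l.+1); rewrite runS /step.
have [i0 i0E] := first_free_ex (clock v (run l)) n_gt0.
have i0min := first_free_Some i0E.
rewrite i0E /= => pE i0t.
have i0F : real (run l) i0 && (t < clock v (run l) i0)%R = false.
  by rewrite ltNge i0t andbF.
move: IH; rewrite [X in (_ <= X)%N -> _](bigD1 i0)//= i0F add0n => IH.
rewrite [X in (_ <= X)%N](bigD1 i0)//= eqxx.
rewrite [X in (_ <= _ + X)%N](_ : _ = \sum_(i < n | i != i0)
   (real (run l) i && (t < clock v (run l) i)%R))%N; last first.
  by apply: eq_bigr => i /negPf ii0; rewrite /clock/= ii0.
case: (boolP (admits u v (run l) i0)) pE => [adm|nadm] pE; last first.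
  by rewrite /nat_of_bool add0n; apply: (leq_trans IH); exact: leq_addl.
rewrite add1n big_ord_recr /= addnA [X in (_ <= X)%N]addnC leq_add//.
set k := served (run l).
have {}pE : v i0 (job (run l) i0).+1 = p k.
  by have := pE k; rewrite ltnS leqnn eqxx => /(_ isT).
rewrite /clock/= eqxx; have [tD/=|//] := boolP (t < D k).
rewrite (lt_le_trans tD)// event_timeS pE lerD2r.
have [j0 j0E] := first_free_ex (W k) n_gt0.
rewrite /start_time j0E ge_max; case/andP: adm => -> _ /=.
exact: le_trans (first_free_Some j0E (s i0)) (sP i0).
Qed.

End window.

(** The customers that the busy system has not served yet form its queue; the
    queue length is the excess of arrivals over usable completions since the
    last customer [j] that found all earlier customers in service. *)
Lemma served_lindley l : exists2 j, (j <= served (run l))%N &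
  (j + \sum_(i < n) \sum_(m < job (run l) i)
      ((event_time u j <= event_time (v i) m)%R &&
       ~~ blocked i (event_time (v i) m)) <= served (run l))%N.
Proof.
elim: l => [|l [j jl IH]].
  by exists 0%N => //; rewrite add0n big1// => i _; rewrite big_ord0.
have past := run_past (l := l) (u := u) n_gt0 v_ge0.
rewrite runS /step.
have [i0 i0E] := first_free_ex (clock v (run l)) n_gt0.
have i0min := first_free_Some i0E.
rewrite i0E /=.
pose F j i := (\sum_(m < job (run l) i) ((event_time u j <= event_time (v i) m)%R &&
       ~~ blocked i (event_time (v i) m)))%N.
pose c j := ((event_time u j <= clock v (run l) i0)%R &&
       ~~ blocked i0 (clock v (run l) i0)).
have FE j' : (\sum_(i < n) \sum_(m < (if i == i0 then (job (run l) i).+1 else job (run l) i))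
      ((event_time u j' <= event_time (v i) m)%R &&
       ~~ blocked i (event_time (v i) m)) = \sum_(i < n) F j' i + c j')%N.
  rewrite (bigD1 i0)//= eqxx big_ord_recr/= [in RHS](bigD1 i0)//=.
  rewrite addnAC; congr (_ + _ + _)%N.
  by apply: eq_bigr => i /negPf ->.
case: (boolP (admits u v (run l) i0)) => [adm|nadm].
  exists j; first by rewrite add1n leqW.
  by rewrite FE addnA add1n -addn1 leq_add// leq_b1.
rewrite add0n; case: (boolP (blocked i0 (clock v (run l) i0))) => bl.
  by exists j => //; rewrite FE /c bl andbF addn0.
move: nadm; rewrite /admits bl andbT -ltNge => late.
exists (served (run l)) => //; rewrite FE /c leNgt late /= addn0.
rewrite big1 ?addn0// => i _; rewrite /F big1// => m _.
by rewrite leNgt (le_lt_trans (past _ _ (ltn_ord m) i0) late).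
Qed.

End comparison.

End busy_system.

Section path_bound.
Context {R : realType} {n : nat}.
Variables (u : nat -> R) (v : 'I_n -> nat -> R) (p : nat -> R).
Variables (t delta : R) (eta : nat).

(** Blocking the servers of rank at least [eta] during the last [delta] units of
    time costs their completions in that window, but ensures that such a server
    holds no customer at time [t] unless it completed nothing in the window. *)
Definition late_block (i : 'I_n) (s : R) := (eta <= i)%N && (t - delta <= s <= t).

Notation run := (run late_block u v).
Notation next := (next_time late_block u v).
Notation D := (departure_time u (fun i => v i 0%N) p).

Hypothesis n_gt0 : (0 < n)%N.
Hypothesis v_ge0 : forall i k, 0 <= v i k.
Hypothesis v_unbounded : forall i M, exists k, M < event_time (v i) k.
Hypothesis run_p : forall l k, (k < served (run l))%N -> proc (run l) k = p k.

Lemma real_before_block l (i : 'I_n) : (forall j, (j < l)%N -> next j <= t) ->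
  (eta <= i)%N -> real (run l) i ->
  forall m, (m < job (run l) i)%N -> event_time (v i) m < t - delta.
Proof.
move=> le_t ei; elim: l le_t => [//|l IH] le_t.
have := le_t l (leqnn _); rewrite runS /step /next_time.
have [i0 i0E] := first_free_ex (clock v (run l)) n_gt0.
rewrite i0E /= => i0t; have {}IH := IH (fun j jl => le_t j (leqW jl)).
case: eqP => // ii0; rewrite -{}ii0 in i0t *.
move=> /andP[_]; rewrite /late_block ei i0t andbT /= -ltNge => early m mi.
by apply: le_lt_trans early; apply: le_event_time.
Qed.

(** At time [t] an early server holds at most one customer, a late one holds
    none if it completed a job since [t - delta], and the queue of the busy
    system is bounded by [served_lindley]. *)
Lemma present_bound (a : nat) : (forall k, (event_time u k <= t) = (k < a)%N) ->
  exists2 N : 'I_n -> nat,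
    forall i k, (event_time (v i) k <= t) = (k < N i)%N &
    exists2 q : nat,
      (\sum_(i < n) (t < v i 0)%R + \sum_(k < a) (t < D k)%R <=
        q + \sum_(i < n) (i < eta) +
        \sum_(i < n | eta <= i) (\sum_(m < N i) (t - delta <= event_time (v i) m)%R == 0))%N &
      q = 0%N \/ exists2 j : nat, (j < a)%N &
        (q + j + \sum_(i < n) \sum_(m < N i)
          ((event_time u j <= event_time (v i) m)%R &&
           ~~ late_block i (event_time (v i) m)) <= a)%N.
Proof.
move=> aP; have [l le_t lt_t] :=
  run_passes late_block u n_gt0 t v_unbounded.
exists (job (run l)) => [i k|].
  apply/idP/idP => [kt|]; last exact: run_job_late.
  rewrite ltnNge; apply: contraTN kt => /(le_event_time (v_ge0 i)).
  by rewrite -ltNge; exact: lt_le_trans (lt_t i).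
set K := served (run l).
exists (a - K)%N; last first.
  have [aK|Ka] := leqP a K; first by left; apply/eqP; rewrite subn_eq0.
  have [j jK H] := served_lindley late_block u n_gt0 v_ge0 l.
  right; exists j; first exact: leq_ltn_trans Ka.
  by move: H Ka; rewrite -/K; lia.
have present := present_le_real n_gt0 v_ge0 run_p le_t.
have waiting : (\sum_(k < a) (t < D k)%R <=
    \sum_(k < K) (t < D k)%R + (a - K))%N.
  have [aK|/ltnW Ka] := leqP a K.
    rewrite (leq_trans _ (leq_addr _ _))// -(subnKC aK) big_split_ord/=.
    exact: leq_addr.
  rewrite -[in X in (X <= _)%N](subnKC Ka) big_split_ord/= leq_add2l.
  rewrite (@leq_trans (\sum_(i < a - K) 1))//.
    by apply: leq_sum => i _; exact: leq_b1.
  by rewrite sum1_card card_ord.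
apply: (@leq_trans
    (\sum_(i < n) (real (run l) i && (t < clock v (run l) i)%R) + (a - K))).
  by move: present waiting; rewrite -/K; lia.
rewrite addnC -addnA leq_add2l.
rewrite [X in (_ <= _ + X)%N]big_mkcond -big_split leq_sum// => i _ /=.
have [ie|ei] := ltnP; first by rewrite (leq_trans (leq_b1 _)).
rewrite lt_t andbT; case: (boolP (real _ _)) => //= ri.
rewrite big1 ?eqxx// => m _.
by rewrite leNgt (real_before_block le_t ei ri).
Qed.

End path_bound.

(** * The bound as a functional of counting functions *)

Section counting.
Context {R : realType}.
Local Open Scope ereal_scope.

Definition events (x : nat -> R) (al be : R) : \bar R :=
  \sum_(0 <= k <oo) ((al <= event_time x k <= be)%R : nat)%:R%:E.

Lemma eseries_nat (b : nat -> nat) (N : nat) : (forall k, (N <= k)%N -> b k = 0%N) ->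
  \sum_(0 <= k <oo) (b k)%:R%:E = (\sum_(k < N) b k)%N%:R%:E :> \bar R.
Proof.
move=> b0; rewrite (@nneseries_split _ _ 0 N)//.
rewrite add0n eseries0 ?adde0; last by move=> k Nk _; rewrite b0.
by rewrite sumEFin big_mkord natr_sum.
Qed.

Lemma events_fin (x : nat -> R) al be N :
  (forall k, (event_time x k <= be)%R = (k < N)%N) ->
  events x al be = (\sum_(k < N) (al <= event_time x k)%R)%N%:R%:E.
Proof.
move=> xN; rewrite /events (@eseries_nat _ N) => [|k Nk].
  by congr (_%:R%:E); apply: eq_bigr => k _; rewrite xN ltn_ord andbT.
by rewrite xN ltnNge Nk andbF.
Qed.

Lemma events_ge0 (x : nat -> R) al be : 0 <= events x al be.
Proof. by apply: nneseries_ge0 => k _ _; rewrite lee_fin. Qed.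

Lemma finite_events (x : nat -> R) t : (forall k, (0 <= x k)%R) ->
  (forall M, exists k, (M < event_time x k)%R) ->
  exists N, forall k, (event_time x k <= t)%R = (k < N)%N.
Proof.
move=> x0 xM.
have /ex_minnP[N tN Nmin] : exists k, (t < event_time x k)%R by exact: xM.
exists N => k; rewrite ltnNge leNgt; congr negb.
apply/idP/idP => [|/(le_event_time x0)]; last exact: lt_le_trans.
exact: Nmin.
Qed.

Variable n : nat.

(** The two terms of the bound are functionals of a family [c] of counting
    functions, whose member [None] counts arrivals, because they occur twice:
    the path argument counts backward from [t], the theorem forward from 0. *)
Definition excess (c : option 'I_n -> R -> \bar R) (delta : R) (J : set R)
    (eta : nat) : \bar R :=
  maxe (ereal_sup [set c None s - \sum_(i < n | (i < eta)%N) c (Some i) s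
                  | s in `[0%R, delta]])
       (ereal_sup [set c None s - \sum_(i < n) c (Some i) s | s in J]
        + \sum_(i < n | (eta <= i)%N) c (Some i) delta).

Definition idle (c : option 'I_n -> R -> \bar R) (delta : R) (eta : nat) : \bar R :=
  \sum_(i < n | (eta <= i)%N) ((c (Some i) delta == 0)%E : nat)%:R%:E.

Definition backward (u : nat -> R) (v : 'I_n -> nat -> R) (t : R)
    (j : option 'I_n) (s : R) : \bar R :=
  if j is Some i then events (v i) (t - s) t else events u (t - s) t.

Definition forward (u : nat -> R) (v : 'I_n -> nat -> R)
    (j : option 'I_n) (s : R) : \bar R :=
  if j is Some i then renewals (v i) s else renewals u s.

(** Let [j] be the last customer that found no queue and [tj] its arrival time.
    If [t - tj <= delta], only the early servers have worked without blocking
    since [tj]; otherwise all have, and the completions lost to blocking are the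
    events of the late servers within [delta].  The maximum with [0] covers the
    case that no customer waits at [t]. *)
Lemma number_in_system_le (u : nat -> R) (v : 'I_n -> nat -> R) (p : nat -> R)
    (t delta : R) (eta : nat) :
  (0 < n)%N -> (eta <= n)%N -> (0 <= delta <= t)%R ->
  (forall k, 0 <= u k)%R -> (forall i k, 0 <= v i k)%R ->
  (forall M, exists k, (M < event_time u k)%R) ->
  (forall i M, exists k, (M < event_time (v i) k)%R) ->
  (forall l k, (k < served (run (late_block t delta eta) u v l))%N ->
    proc (run (late_block t delta eta) u v l) k = p k) ->
  (number_in_system u (fun i => v i 0%N) p t)%:E - eta%:R%:E <=
    maxe 0 (excess (backward u v t) delta `[delta, t] eta) +
    idle (backward u v t) delta eta.
Proof.
move=> n0 en /andP[d0 dt] u0 v0 uM vM pP.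
have [a aP] := finite_events t u0 uM.
have [N NP [q qle qE]] := present_bound n0 v0 vM pP aP.
have -> : number_in_system u (fun i => v i 0%N) p t =
  (\sum_(i < n) (t < v i 0)%R + \sum_(k < a)
     (t < departure_time u (fun i => v i 0%N) p k)%R)%N%:R.
  rewrite /number_in_system natrD natr_sum; congr (_ + _)%R.
  rewrite (@eseries_nat _ a) /=; last by move=> k ak; rewrite aP ltnNge ak.
  by congr _%:R; apply: eq_bigr => k _; rewrite aP ltn_ord.
rewrite leeBlDr//.
pose I := (\sum_(i < n | eta <= i)
  (\sum_(m < N i) (t - delta <= event_time (v i) m)%R == 0))%N.
have idleE : idle (backward u v t) delta eta = I%:R%:E.
  rewrite /idle /I natr_sum -sumEFin; apply: eq_bigr => i _.
  by rewrite /= (events_fin _ (NP i)) eqe pnatr_eq0.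
have sumeta : (\sum_(i < n) (i < eta))%N = eta.
  transitivity (\sum_(i < eta) 1)%N; last by rewrite sum1_card card_ord.
  rewrite (big_ord_widen _ (fun=> 1%N) en) [RHS]big_mkcond.
  by apply: eq_bigr => i _; case: ifP.
apply: (@le_trans _ _ (q + eta + I)%N%:R%:E).
  by rewrite lee_fin ler_nat (leq_trans qle)// sumeta.
rewrite idleE !natrD !EFinD addeAC leeD2r// leeD2r//.
case: qE => [->|[j ja qE]]; first by rewrite le_max lexx.
rewrite le_max; apply/orP; right.
set tj := event_time u j.
have tjt : (tj <= t)%R by rewrite aP.
have arrivals : (a - j)%N%:R%:E <= backward u v t None (t - tj)%R.
  rewrite /= opprB addrC subrK (events_fin _ aP) lee_fin ler_nat.
  rewrite -(subnKC (ltnW ja)) addKn big_split_ord/= (leq_trans _ (leq_addl _ _))//.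
  rewrite (@leq_trans (\sum_(i < a - j) 1))//; first by rewrite sum1_card card_ord.
  by apply: leq_sum => i _; rewrite le_event_time// leq_addr.
have services i : backward u v t (Some i) (t - tj)%R =
    (\sum_(m < N i) (tj <= event_time (v i) m)%R)%N%:R%:E.
  by rewrite /= opprB addrC subrK (events_fin _ (NP i)).
have tj0 : (0 <= tj)%R by rewrite (le_trans (u0 0%N))// -event_time0 le_event_time.
rewrite /excess le_max; have [late|early] := leP (t - tj)%R delta; apply/orP.
  left; apply: le_ereal_sup_tmp.
  exists (backward u v t None (t - tj)%R -
    \sum_(i < n | (i < eta)%N) backward u v t (Some i) (t - tj)%R).
    by exists (t - tj)%R => //=; rewrite in_itv/= late subr_ge0 tjt.
  under eq_bigr do rewrite services.
  rewrite sumEFin -natr_sum leeBrDr//; apply: le_trans arrivals.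
  rewrite -EFinD -natrD lee_fin ler_nat leq_subRL; last exact: ltnW.
  apply: leq_trans qE; rewrite addnA [(j + q)%N]addnC leq_add2l.
  rewrite big_mkcond leq_sum// => i _; case: ifP => // ie.
  by apply: leq_sum => m _; rewrite /late_block (leqNgt eta) ie/= andbT.
right; pose L := (\sum_(i < n | eta <= i) \sum_(m < N i)
  (t - delta <= event_time (v i) m)%R)%N.
apply: (@le_trans _ _ (backward u v t None (t - tj)%R -
    \sum_(i < n) backward u v t (Some i) (t - tj)%R + L%:R%:E)); last first.
  rewrite leeD//.
    apply: ereal_sup_ubound; exists (t - tj)%R => //=.
    by rewrite in_itv/= (ltW early)/= lerBlDr lerDl.
  rewrite /L natr_sum -sumEFin le_eqVlt; apply/orP; left; apply/eqP.
  by apply: eq_bigr => i _; rewrite /= (events_fin _ (NP i)).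
under eq_bigr do rewrite services.
rewrite sumEFin -natr_sum addeAC leeBrDr//.
apply: (@le_trans _ _ ((a - j)%N%:R%:E + L%:R%:E)); last by rewrite leeD2r.
rewrite -!EFinD -!natrD lee_fin ler_nat.
rewrite -(leq_add2r j) addnAC [X in (_ <= X)%N]addnAC (subnK (ltnW ja)).
apply: (leq_trans _ (leq_add qE (leqnn L))).
rewrite -[X in (_ <= X)%N]addnA leq_add2l /L [X in (_ <= _ + X)%N]big_mkcond -big_split/=.
apply: leq_sum => i _; case: ifPn => [ei|]; last first.
  rewrite -ltnNge => ie; rewrite addn0.
  by apply: leq_sum => m _; rewrite /late_block (leqNgt eta) ie/= andbT.
rewrite -big_split/=; apply: leq_sum => m _.
rewrite /late_block ei/= NP ltn_ord andbT.
by do 2 case: (_ <= _)%R.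
Qed.

End counting.

(** * Measurability of the queue and of the busy system *)

Section measurable_switch.
Context d (T : measurableType d).

(** The queue and the busy system branch on discrete data only: which server is
    free first, whether it admits a customer, how many jobs it has done. *)
Lemma measurable_switch d' (T' : measurableType d') (K : countType) (k : T -> K)
    (F : K -> T -> T') :
  (forall c, measurable [set w | k w = c]) ->
  (forall c, measurable_fun setT (F c)) ->
  measurable_fun setT (fun w => F (k w) w).
Proof.
move=> mk mF _ A mA; rewrite setTI.
rewrite (_ : _ @^-1` A = \bigcup_c ([set w | k w = c] `&` F c @^-1` A)).
  apply: countable_bigcupT_measurable => // c.
  by apply: measurableI => //; exact: measurable_preimageT.
apply/seteqP; split => [w Aw|w [c _ [<-]]//].
by exists (k w).
Qed.

Lemma measurable_fiber (k : T -> nat) (c : nat) :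
  measurable_fun setT k -> measurable [set w | k w = c].
Proof. by move=> mk; exact: (measurable_preimageT mk (A := [set c])). Qed.

Lemma measurable_boolP (b : T -> bool) :
  measurable_fun setT b <-> measurable [set w | b w].
Proof.
split=> [mb|mb]; first exact: (measurable_preimageT mb (A := [set true])).
by apply: (measurable_fun_bool true); rewrite setTI.
Qed.

Lemma measurable_fun_natr (R : realType) (f : T -> nat) :
  measurable_fun setT f -> measurable_fun setT (fun w => (f w)%:R : R).
Proof.
move=> mf.
apply: (measurable_switch (K := nat) (F := fun c (_ : T) => c%:R : R)) => c.
  exact: measurable_fiber.
exact: measurable_cst.
Qed.

Lemma measurable_nat_of_bool (b : T -> bool) :
  measurable_fun setT b -> measurable_fun setT (fun w => b w : nat).
Proof.
by move=> mb; apply: measurable_fun_ifT => //; exact: measurable_cst.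
Qed.

Context {R : realType} {n : nat}.

Lemma measurable_first_free (W : T -> 'I_n -> R) o :
  (forall i, measurable_fun setT (W^~ i)) ->
  measurable [set w | first_free (W w) = o].
Proof.
move=> mW.
pose k w : {ffun 'I_n * 'I_n -> bool} := [ffun ij => W w ij.1 <= W w ij.2].
pose pick_of (c : {ffun 'I_n * 'I_n -> bool}) := [pick i | [forall j, c (i, j)]].
have kE w : first_free (W w) = pick_of (k w).
  by apply: eq_pick => i; apply: eq_forallb => j; rewrite ffunE.
have mk c : measurable [set w | k w = c].
  rewrite (_ : [set _ | _] =
      \bigcap_(ij in [set: 'I_n * 'I_n]) [set w | (W w ij.1 <= W w ij.2) = c ij]).
    apply: fin_bigcap_measurable => // ij _.
    have mle : measurable_fun setT (fun w => W w ij.1 <= W w ij.2).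
      exact: measurable_fun_ler.
    exact: (measurable_preimageT mle (A := [set c ij])).
  apply/seteqP; split => [w <- ij _|w kw]; first by rewrite /= ffunE.
  by apply/ffunP => ij; rewrite ffunE; exact: kw.
rewrite (_ : [set _ | _] = \bigcup_(c in [set c | pick_of c = o]) [set w | k w = c]).
  by apply: fin_bigcup_measurable.
by apply/seteqP; split => [w <-|w [c /= <- <-]]; [exists (k w) => //=; rewrite kE|rewrite kE].
Qed.

Lemma measurable_event_time (x : T -> nat -> R) k :
  (forall j, measurable_fun setT (x^~ j)) ->
  measurable_fun setT (fun w => event_time (x w) k).
Proof. by move=> mx; apply: measurable_sum. Qed.

Lemma measurable_events (x : T -> nat -> R) (al be : T -> R) :
  (forall j, measurable_fun setT (x^~ j)) ->
  measurable_fun setT al -> measurable_fun setT be ->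
  measurable_fun setT (fun w => events (x w) (al w) (be w)).
Proof.
move=> mx mal mbe; apply: ge0_emeasurable_sum => [k w _ _|k _].
  by rewrite lee_fin.
apply/measurable_EFinP; apply: measurable_fun_natr; apply: measurable_nat_of_bool.
by apply: measurable_and; apply: measurable_fun_ler => //; exact: measurable_event_time.
Qed.

Section queue.
Variables (a : T -> nat -> R) (r : T -> 'I_n -> R) (p : T -> nat -> R).
Hypothesis ma : forall k, measurable_fun setT (a^~ k).
Hypothesis mr : forall i, measurable_fun setT (r^~ i).
Hypothesis mp : forall k, measurable_fun setT (p^~ k).

Lemma measurable_start_time (W : T -> 'I_n -> R) (s : T -> R) :
  (forall i, measurable_fun setT (W^~ i)) -> measurable_fun setT s ->
  measurable_fun setT (fun w => start_time (W w) (s w)).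
Proof.
move=> mW ms; apply: (measurable_switch (K := option 'I_n)
  (k := fun w => first_free (W w))
  (F := fun o w => if o is Some i then Num.max (s w) (W w i) else s w)).
  by move=> o; exact: measurable_first_free.
by case=> [i|] //; exact: measurable_maxr.
Qed.

Lemma measurable_free_times k i :
  measurable_fun setT (fun w => free_times (a w) (r w) (p w) k i).
Proof.
elim: k => [|k IH] in i *; first exact: mr.
rewrite /=; apply: (measurable_fun_ifT (f := fun w =>
  first_free (free_times (a w) (r w) (p w) k) == Some i)).
- apply/measurable_boolP.
  rewrite (_ : [set _ | _] = [set w | first_free (free_times (a w) (r w) (p w) k) = Some i]).
    exact: measurable_first_free.
  by apply/seteqP; split => w /eqP.
- apply: measurable_funD => //; apply: measurable_start_time => //.
  exact: measurable_event_time.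
- exact: IH.
Qed.

Lemma measurable_departure_time k :
  measurable_fun setT (fun w => departure_time (a w) (r w) (p w) k).
Proof.
apply: measurable_funD => //; apply: measurable_start_time.
  exact: measurable_free_times.
exact: measurable_event_time.
Qed.

Lemma measurable_number_in_system t :
  measurable_fun setT (fun w => number_in_system (a w) (r w) (p w) t).
Proof.
apply: measurable_funD.
  apply: measurable_sum => i; apply: measurable_fun_natr.
  by apply: measurable_nat_of_bool; exact: measurable_fun_ltr.
apply: (measurableT_comp (@fine_measurable R setT measurableT)).
apply: ge0_emeasurable_sum => [k w _ _|k _]; first by rewrite lee_fin.
apply/measurable_EFinP; apply: measurable_fun_natr; apply: measurable_nat_of_bool.
apply: measurable_and.
  by apply: measurable_fun_ler => //; exact: measurable_event_time.
by apply: measurable_fun_ltr => //; exact: measurable_departure_time.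
Qed.

End queue.

Section busy.
Variables (blocked : 'I_n -> R -> bool).
Hypothesis mblocked : forall i, measurable_fun setT (blocked i).
Variables (u : T -> nat -> R) (v : T -> 'I_n -> nat -> R).
Hypothesis mu : forall k, measurable_fun setT (u^~ k).
Hypothesis mv : forall i k, measurable_fun setT (fun w => v w i k).

Notation run w := (run blocked (u w) (v w)).

Lemma measurable_clock_job (k : T -> nat) i : measurable_fun setT k ->
  measurable_fun setT (fun w => event_time (v w i) (k w)).
Proof.
move=> mk; apply: (measurable_switch (K := nat)
  (F := fun c w => event_time (v w i) c)) => c.
  exact: measurable_fiber.
by apply: measurable_event_time => j; exact: mv.
Qed.

Lemma measurable_run l :
  [/\ forall i, measurable_fun setT (fun w => job (run w l) i),
      measurable_fun setT (fun w => served (run w l)),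
      forall k, measurable_fun setT (fun w => proc (run w l) k),
      forall i, measurable_fun setT (fun w => clock (v w) (run w l) i) &
      forall i, measurable_fun setT (fun w => admits blocked (u w) (v w) (run w l) i)].
Proof.
have madm l' : (forall i, measurable_fun setT (fun w => job (run w l') i)) ->
    measurable_fun setT (fun w => served (run w l')) -> forall i,
    measurable_fun setT (fun w => admits blocked (u w) (v w) (run w l') i).
  move=> mj ms i; have mc := measurable_clock_job i (mj i).
  apply: measurable_and; last first.
    by apply: measurable_neg; exact: measurableT_comp.
  apply: measurable_fun_ler => //.
  apply: (measurable_switch (K := nat) (F := fun c w => event_time (u w) c)) => c.
    exact: measurable_fiber.
  exact: measurable_event_time.
suff : [/\ forall i, measurable_fun setT (fun w => job (run w l) i),
      measurable_fun setT (fun w => served (run w l)) &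
      forall k, measurable_fun setT (fun w => proc (run w l) k)].
  move=> [mj ms mp]; split=> //; last exact: madm.
  by move=> i; exact: measurable_clock_job.
elim: l => [|l [mj ms mp]]; first by split=> *; exact: measurable_cst.
have mc i := measurable_clock_job i (mj i).
have {}madm := madm l mj ms.
have mff o : measurable [set w | first_free (clock (v w) (run w l)) = o].
  exact: measurable_first_free.
split=> [i||k].
- pose F o w := if o == Some i then (job (run w l) i).+1 else job (run w l) i.
  rewrite (_ : (fun w => _) = fun w => F (first_free (clock (v w) (run w l))) w).
    apply: measurable_switch => // o; rewrite /F; case: (o == Some i) => //.
    by apply: (measurableT_comp (f := S)).
  apply/funext => w; rewrite /F runS /step; case: first_free => //= j.
  by rewrite (inj_eq Some_inj) eq_sym.
- pose F o w := if o is Some i then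
    (admits blocked (u w) (v w) (run w l) i + served (run w l))%N
    else served (run w l).
  rewrite (_ : (fun w => _) = fun w => F (first_free (clock (v w) (run w l))) w).
    apply: measurable_switch => //; case=> [i|//].
    by apply: measurable_fun_addn => //; exact: measurable_nat_of_bool.
  by apply/funext => w; rewrite runS /step; case: first_free.
- pose F o w := if o is Some i then
       if admits blocked (u w) (v w) (run w l) i && (k == served (run w l))
       then v w i (job (run w l) i).+1 else proc (run w l) k
       else proc (run w l) k.
  rewrite (_ : (fun w => _) = fun w => F (first_free (clock (v w) (run w l))) w);
    last by apply/funext => w; rewrite runS /step; case: first_free.
  apply: measurable_switch => //; case=> [i|]; last exact: mp.
  apply: measurable_fun_ifT => //.
    apply: measurable_and => //; apply/measurable_boolP.
    rewrite (_ : [set _ | _] = [set w | served (run w l) = k]).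
      exact: measurable_fiber.
    by apply/seteqP; split => w /= => [/eqP|] ->.
  apply: (measurable_switch (K := nat) (F := fun c w => v w i c.+1)) => c //.
  exact: measurable_fiber.
Qed.

End busy.

End measurable_switch.

(** * The customers' processing times in the busy system *)

Section countable_partition.
Local Open Scope ereal_scope.
Context {R : realType} d (T : measurableType d) (P : probability T R).

Lemma measure_eq1I (G A : set T) : measurable G -> measurable A -> P A = 1 ->
  P (G `&` A) = P G.
Proof.
move=> mG mA PA; have PAc : P (~` A) = 0.
  by rewrite probability_setC// PA subee.
rewrite -[in RHS](setUIDK G A) measureU.
- rewrite [X in _ + X](_ : _ = 0) ?adde0//; apply/eqP; rewrite -measure_le0 -PAc.
  apply: le_measure; rewrite ?inE; [exact: measurableD|exact: measurableC|].
  by rewrite setDE; exact: subIsetr.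
- exact: measurableI.
- exact: measurableD.
- by apply/seteqP; split => w // -[[_ Aw] [_ nAw]].
Qed.

Lemma measure_partition (K : countType) (A : K -> set T) (G : set T) :
  (forall c, measurable (A c)) -> measurable G ->
  (forall c c' w, A c w -> A c' w -> c = c') -> P (\bigcup_c A c) = 1 ->
  P G = \sum_(0 <= j <oo) (if @pickle_inv K j is Some c then P (G `&` A c) else 0).
Proof.
move=> mA mG trA PA.
pose B j := if @pickle_inv K j is Some c then A c else set0.
have mB j : measurable (B j) by rewrite /B; case: pickle_inv.
have BA : \bigcup_j B j = \bigcup_c A c.
  apply/seteqP; split => [w [j _]|w [c _ Aw]].
    by rewrite /B; case: pickle_inv => // c Aw; exists c.
  by exists (pickle c) => //; rewrite /B pickleK_inv.
rewrite -(measure_eq1I mG _ PA); last by rewrite -BA; exact: bigcupT_measurable.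
rewrite -BA setI_bigcupr measure_semi_bigcup//.
- apply: eq_eseriesr => j _; rewrite /B; case: pickle_inv => //.
  by rewrite setI0 measure0.
- by move=> j; exact: measurableI.
- apply/trivIsetP => j j' _ _; apply: contraNeq => /set0P[w [[_ +] [_]]].
  rewrite /B; case E: (@pickle_inv K j) => [c|//]; case E' : (@pickle_inv K j') => [c'|//].
  move=> Aw /(trA _ _ _ Aw) cc'.
  have := @pickle_invK K j; have := @pickle_invK K j'.
  by rewrite E E' /= cc' => -> ->.
- by apply: bigcupT_measurable => j; exact: measurableI.
Qed.

End countable_partition.

Section recorded_times.
Context {R : realType} {n : nat}.
Variable blocked : 'I_n -> R -> bool.
Hypothesis n_gt0 : (0 < n)%N.

Definition arrival_gaps (f : option 'I_n * nat -> R) (k : nat) : R := f (None, k).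
Definition service_gaps (f : option 'I_n * nat -> R) (i : 'I_n) (k : nat) : R :=
  f (Some i, k).

Notation busy f l := (run blocked (arrival_gaps f) (service_gaps f) l).

(** A customer that is never served gets the default [0]; almost surely there is
    none. *)
Definition recorded (f : option 'I_n * nat -> R) (k : nat) : R :=
  if pselect (exists l, (k < served (busy f l))%N) is left h
  then proc (busy f (sval (cid h))) k else 0.

Lemma recordedE f l k : (k < served (busy f l))%N ->
  proc (busy f l) k = recorded f k.
Proof.
move=> kl; rewrite /recorded; case: pselect => [h|]; last by case; exists l.
case: (cid h) => l' /= kl'.
have [ll'|/ltnW ll'] := leqP l l'; first by rewrite (run_proc_stable ll').
exact: run_proc_stable.
Qed.

(** In the ordinary queue the initial jobs are the first jobs of the servers, and
    each customer brings the time that the busy system has recorded for it. *)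
Definition queue_input (f : option 'I_n * nat -> R) (j : nat + 'I_n + nat) : R :=
  match j with
  | inl (inl k) => arrival_gaps f k
  | inl (inr i) => service_gaps f i 0%N
  | inr k => recorded f k
  end.

(** The choice [c = (l, i, m)] stands for: customer [K] enters service at step
    [l], on server [i], when the rank of the job just completed there is [m].
    Its processing time is then entry [m.+1] of server [i]. *)
Definition admission (K : nat) (c : nat * 'I_n * nat) : set (pathspace R _) :=
  [set f | [/\ served (busy f c.1.1) = K,
    first_free (clock (service_gaps f) (busy f c.1.1)) = Some c.1.2,
    admits blocked (arrival_gaps f) (service_gaps f) (busy f c.1.1) c.1.2 &
    job (busy f c.1.1) c.1.2 = c.2]].

Lemma admission_served K c f : admission K c f ->
  served (busy f c.1.1.+1) = K.+1.
Proof. by move=> [sK ffE adm _]; rewrite runS /step ffE /= adm sK. Qed.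

Lemma admission_recorded K c f : admission K c f ->
  recorded f K = f (Some c.1.2, c.2.+1).
Proof.
move=> /[dup] cK [sK ffE adm jE].
rewrite -(recordedE (l := c.1.1.+1)) ?(admission_served cK)//.
by rewrite runS /step ffE /= adm sK eqxx jE.
Qed.

Lemma admission_uniq K c c' f : admission K c f -> admission K c' f -> c = c'.
Proof.
have lt_served c1 c2 : admission K c1 f -> admission K c2 f -> (c1.1.1 <= c2.1.1)%N.
  move=> /[dup] h1 [s1 _ _ _] h2; rewrite leqNgt; apply/negP => lt21.
  have := run_served_le blocked (arrival_gaps f) (service_gaps f) lt21.
  by rewrite (admission_served h2) s1 ltnn.
move=> h h'; have /eqP ll' : c.1.1 == c'.1.1 by rewrite eqn_leq !lt_served.
case: h h' => _ ff _ jj [_ ff' _ jj'].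
move: ff'; rewrite -ll' ff => -[ii']; move: jj'; rewrite -ll' -ii' jj.
by move: c c' ll' ii' {ff jj} => [[? ?] ?] [[? ?] ?] /= -> -> ->.
Qed.

Lemma measurable_arrival_gaps k :
  measurable_fun setT (fun f : pathspace R (option 'I_n * nat) => arrival_gaps f k).
Proof. exact: measurable_coord. Qed.

Lemma measurable_service_gaps i k :
  measurable_fun setT (fun f : pathspace R (option 'I_n * nat) => service_gaps f i k).
Proof. exact: measurable_coord. Qed.

Hypothesis mblocked : forall i, measurable_fun setT (blocked i).

Let mrun l := @measurable_run _ (pathspace R (option 'I_n * nat)) R n blocked
  mblocked arrival_gaps service_gaps measurable_arrival_gaps
  measurable_service_gaps l.

Lemma measurable_recorded k :
  measurable_fun setT (fun f : pathspace R (option 'I_n * nat) => recorded f k).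
Proof.
apply: (measurable_fun_cvg
  (h := fun l (f : pathspace R (option 'I_n * nat)) => proc (busy f l) k)).
- by move=> l; have [] := mrun l.
- move=> f _; apply: (@cvg_near_cst _ _ _ (fun l => proc (busy f l) k)).
  have [[l kl]|h] := pselect (exists l, (k < served (busy f l))%N).
    near=> l'; rewrite recordedE//; apply: (leq_trans kl); apply: run_served_le.
    by near: l'; exact: nbhs_infty_ge.
  near=> l'; rewrite /recorded; case: pselect => // _.
  by rewrite run_proc_default// leqNgt; apply/negP => kl; apply: h; exists l'.
Unshelve. all: by end_near.
Qed.

Lemma measurable_queue_input :
  measurable_fun [set: pathspace R (option 'I_n * nat)]
    (queue_input : _ -> pathspace R (nat + 'I_n + nat)).
Proof.
apply: measurable_pathspace => -[[k|i]|k].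
- exact: measurable_arrival_gaps.
- exact: measurable_service_gaps.
- exact: measurable_recorded.
Qed.

Lemma measurable_admission K c : measurable (admission K c).
Proof.
have [mj ms _ mc ma] := mrun c.1.1.
rewrite (_ : admission K c =
  [set f | served (busy f c.1.1) = K] `&`
  [set f | first_free (clock (service_gaps f) (busy f c.1.1)) = Some c.1.2] `&`
  [set f | admits blocked (arrival_gaps f) (service_gaps f) (busy f c.1.1) c.1.2] `&`
  [set f | job (busy f c.1.1) c.1.2 = c.2]).
  apply: measurableI; last exact: measurable_fiber.
  apply: measurableI; last exact/measurable_boolP.
  apply: measurableI; first exact: measurable_fiber.
  exact: measurable_first_free.
by apply/seteqP; split => [f []|f [[[]]]].
Qed.

(** Up to the moment a server is about to start its job [m.+1], the run has not
    read the duration of that job. *)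
Lemma run_insensitive l i m f g : (job (busy f l) i <= m)%N ->
  (forall j, j != (Some i, m.+1) -> f j = g j) -> busy g l = busy f l.
Proof.
move=> + fg; elim: l => [//|l IH] jm.
have {}IH := IH (leq_trans (run_job_le _ _ _ i (leqnSn l)) jm).
rewrite runS IH [in RHS]runS; rewrite runS in jm.
have clockE : clock (service_gaps g) (busy f l) = clock (service_gaps f) (busy f l).
  apply/funext => i'; apply: eq_bigr => k _; rewrite /service_gaps -fg//.
  apply: contraTneq jm => -[<- kE]; rewrite -ltnNge.
  have := run_job_le blocked (arrival_gaps f) (service_gaps f) i' (leqnSn l).
  by rewrite runS; apply: leq_trans; rewrite -kE -ltnS.
have arrE : arrival_gaps g = arrival_gaps f.
  by apply/funext => k; rewrite /arrival_gaps fg.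
rewrite {1}/step {1}clockE [in RHS]/step.
move: jm; rewrite /step; case: first_free => //= i0 jm.
have admE : admits blocked (arrival_gaps g) (service_gaps g) (busy f l) i0 =
    admits blocked (arrival_gaps f) (service_gaps f) (busy f l) i0.
  by rewrite /admits clockE arrE.
rewrite admE; congr State; apply/funext => k.
case: ifP => // _; apply/esym/fg; apply: contraTneq jm => -[-> ->].
by rewrite eqxx -ltnNge.
Qed.

Lemma admission_insensitive K c D : 
  insensitive (Some c.1.2, c.2.+1)
    (admission K c `&` [set f | forall k, (k < K)%N -> D k (recorded f k)]).
Proof.
move=> f g fg [] /[dup] cf [sK ffE adm jE] Df.
have runE : busy g c.1.1 = busy f c.1.1 by apply: run_insensitive fg; rewrite jE.
have clockE : clock (service_gaps g) (busy f c.1.1) =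
    clock (service_gaps f) (busy f c.1.1).
  apply/funext => i; apply: eq_bigr => k _; rewrite /service_gaps -fg//.
  apply/eqP => -[iE kE]; have := ltn_ord k; rewrite kE {1}iE jE.
  by rewrite ltnS ltnn.
have cg : admission K c g.
  split; rewrite ?runE ?clockE//; rewrite /admits clockE.
  by rewrite (_ : arrival_gaps g = arrival_gaps f)//; apply/funext => k; rewrite /arrival_gaps fg.
split=> // k kK; have := Df k kK.
by rewrite -(recordedE (l := c.1.1)) ?sK// -(recordedE (l := c.1.1)) ?runE ?sK.
Qed.

(** Once no server is blocked any more and customer [K] has arrived, each
    completion lets a waiting customer enter service. *)
Lemma admission_cover K f b : (forall i s, b < s -> ~~ blocked i s) ->
  (forall i k, 0 <= service_gaps f i k) ->
  (forall i M, exists k, M < event_time (service_gaps f i) k) ->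
  exists c, admission K c f.
Proof.
move=> unblocked v0 vM.
have served_ge k : exists l, (k <= served (busy f l))%N.
  elim: k => [|k [l kl]]; first by exists 0%N.
  have [l' _ l'P] := run_passes blocked (arrival_gaps f) n_gt0
    (Num.max b (event_time (arrival_gaps f) k)) vM.
  pose L := maxn l l'.
  have := leq_trans kl (run_served_le blocked (arrival_gaps f) (service_gaps f)
    (leq_maxl l l')).
  rewrite leq_eqVlt => /predU1P[kE|]; last by exists L.
  have [i0 i0E] := first_free_ex (clock (service_gaps f) (busy f L)) n_gt0.
  exists L.+1; rewrite runS /step i0E /= -kE -add1n leq_add2r lt0b.
  have : Num.max b (event_time (arrival_gaps f) k) < clock (service_gaps f) (busy f L) i0.
    apply: lt_le_trans (l'P i0) _; apply: le_event_time => //.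
    by apply: run_job_le; exact: leq_maxr.
  by rewrite gt_max /admits -kE => /andP[/unblocked -> /ltW ->].
have /ex_minnP[l lK lmin] := served_ge K.+1.
case: l => [|l] in lK lmin *; first by rewrite ltn0 in lK.
have lK' : (served (busy f l) <= K)%N.
  by rewrite leqNgt; apply/negP => /lmin; rewrite ltnn.
have [i0 i0E] := first_free_ex (clock (service_gaps f) (busy f l)) n_gt0.
exists (l, i0, job (busy f l) i0).
move: lK; rewrite runS /step i0E /=; case: (boolP (admits _ _ _ _ _)) => adm.
  by rewrite add1n ltnS => Kl; split=> //=; apply/eqP; rewrite eqn_leq lK'.
by rewrite add0n ltnNge lK'.
Qed.

End recorded_times.

Section coupling.
Context {R : realType} {n : nat}.
Variable blocked : 'I_n -> R -> bool.
Hypothesis mblocked : forall i, measurable_fun setT (blocked i).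
Local Open Scope ereal_scope.

Context d0 (T0 : measurableType d0) (P0 : probability T0 R) (V : {RV P0 >-> R}).
Context d (T : measurableType d) (P : probability T R)
  (X : option 'I_n * nat -> {RV P >-> R}).
Hypothesis iX : mutually_independent X.
Hypothesis XV : forall i k, same_law V (X (Some i, k.+1)).
Hypothesis all_admitted : forall K,
  P (\bigcup_c joint X @^-1` admission blocked K c) = 1.

Notation recorded := (recorded blocked).

Lemma measurable_recorded_in K (D : nat -> set R) : (forall k, measurable (D k)) ->
  measurable [set f : pathspace R (option 'I_n * nat) |
    forall k, (k < K)%N -> D k (recorded f k)].
Proof.
move=> mD; rewrite (_ : [set _ | _] = \bigcap_(k in [set k | (k < K)%N])
  (fun f : pathspace R (option 'I_n * nat) => recorded f k) @^-1` D k).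
  apply: bigcap_measurableType => k _.
  by apply: measurable_preimageT => //; exact: measurable_recorded.
by apply/seteqP; split.
Qed.

(** Whichever server admits customer [K], the duration it is given has not been
    read before, hence is independent of all that led to this choice; summing
    over the possible choices makes the recorded times i.i.d. *)
Lemma recorded_iid K (E : set (pathspace R (option 'I_n * nat)))
    (D : nat -> set R) :
  measurable E -> (forall i m, insensitive (Some i, m.+1) E) ->
  (forall k, measurable (D k)) ->
  P (joint X @^-1` (E `&` [set f | forall k, (k < K)%N -> D k (recorded f k)])) =
  P (joint X @^-1` E) * \prod_(0 <= k < K) P0 (V @^-1` D k).
Proof.
move=> mE iE mD; elim: K => [|K IH].
  rewrite big_geq// mule1 (_ : [set f | _] = setT) ?setIT//.
  by apply/seteqP; split.
rewrite big_nat_recr//= muleA -{}IH.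
set H := (W in _ = P (_ @^-1` (E `&` W)) * _).
have mA c : measurable (joint X @^-1` admission blocked K c).
  by apply: measurable_preimageT; [exact: measurable_joint|exact: measurable_admission].
have mG : measurable (joint X @^-1` (E `&` H)).
  apply: measurable_preimageT; first exact: measurable_joint.
  by apply: measurableI => //; exact: measurable_recorded_in.
have uniqA c c' w : (joint X @^-1` admission blocked K c) w ->
    (joint X @^-1` admission blocked K c') w -> c = c' by exact: admission_uniq.
rewrite (measure_partition mA _ uniqA (all_admitted K)); last first.
  apply: measurable_preimageT; first exact: measurable_joint.
  by apply: measurableI => //; exact: measurable_recorded_in.
rewrite [in RHS](measure_partition mA mG uniqA (all_admitted K)).
have mVD : measurable (V @^-1` D K).
  by apply: measurable_preimageT => //; exact: measurable_funP.
have PVD : P0 (V @^-1` D K) \is a fin_num by rewrite fin_num_measure.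
rewrite -(fineK PVD) muleC -nneseriesZl; last by move=> j _; case: pickle_inv.
apply: eq_eseriesr => j _; case: pickle_inv => [c|]; last by rewrite mule0.
have XVc : P0 (V @^-1` D K) = P (X (Some c.1.2, c.2.+1) @^-1` D K).
  exact: XV.
rewrite (fineK PVD) XVc muleC.
pose S := E `&` (admission blocked K c `&` H).
have mS : measurable S.
  apply: measurableI => //; apply: measurableI; first exact: measurable_admission.
  exact: measurable_recorded_in.
have iS : insensitive (Some c.1.2, c.2.+1) S.
  move=> f g fg [Ef cHf]; split; first exact: iE fg Ef.
  exact: admission_insensitive fg cHf.
have -> : joint X @^-1` (E `&` H) `&` joint X @^-1` admission blocked K c =
    joint X @^-1` S.
  by rewrite -preimage_setI -setIA [H `&` _]setIC.
rewrite -[RHS](independent_insensitive iX mS iS (mD K)).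
congr (P _); apply/seteqP; split => w /=.
  move=> [[Ew DK] cw]; split; last first.
    by rewrite -[X _ w](admission_recorded cw); exact: DK.
  by split=> //; split=> // k kK; apply: DK; exact: ltnW.
move=> [[Ew [cw Hw]]]; rewrite -[X _ w](admission_recorded cw) => DK.
split=> //; split=> // k; rewrite ltnS leq_eqVlt => /predU1P[->//|].
exact: Hw.
Qed.

Context d' (T' : measurableType d') (P' : probability T' R)
  (Y : nat + 'I_n + nat -> {RV P' >-> R}).
Hypothesis iY : mutually_independent Y.
Hypothesis Ya : forall k, same_law (Y (inl (inl k))) (X (None, k)).
Hypothesis Yr : forall i, same_law (Y (inl (inr i))) (X (Some i, 0%N)).
Hypothesis Yp : forall k, same_law V (Y (inr k)).

(** Initial jobs and arrivals are coordinates of [X] other than the durations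
    handed to customers, so [recorded_iid] applies to events about them. *)
Lemma queue_input_law (A : set (pathspace R (nat + 'I_n + nat))) : measurable A ->
  P' (joint Y @^-1` A) = P ((queue_input blocked \o joint X) @^-1` A).
Proof.
move=> mA.
have := @eq_law_pathspace R _ _ _ _ (nat + 'I_n + nat)%type P' P (joint Y)
  (queue_input blocked \o joint X) setT setT 1 ler01 (measurable_joint _).
have mq : measurable_fun setT (queue_input blocked \o joint X :
    T -> pathspace R (nat + 'I_n + nat)).
  by apply: measurableT_comp; [exact: measurable_queue_input|exact: measurable_joint].
have P'T : P' setT < +oo by rewrite probability_setT ltry.
move=> /(_ mq measurableT measurableT P'T) H.
suff H0 : forall (l : seq (nat + 'I_n + nat)) (B : nat + 'I_n + nat -> set R),
    uniq l -> (forall i, measurable (B i)) ->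
    P' ([set: T'] `&` joint Y @^-1` cylinder l B) =
    1 * P ([set: T] `&` (queue_input blocked \o joint X) @^-1` cylinder l B).
  by have := H H0 A mA; rewrite !setTI mul1e.
move=> {H mA} l B ul mB; rewrite !setTI mul1e.
pose C j := if j \in l then B j else setT.
have mC j : measurable (C j) by rewrite /C; case: ifP.
have [K KP] : exists K, forall j, j \in l ->
    match j with inl (inl k) => (k < K)%N | inr k => (k < K)%N | _ => true end.
  elim: (l) => [|j s [K KP]]; first by exists 0%N.
  exists (maxn (match j with inl (inl k) => k.+1 | inr k => k.+1 | _ => 0%N end) K).
  move=> j'; rewrite inE => /predU1P[->|/KP].
    by case: (j) => [[k|i]|k] //; rewrite leq_maxl.
  by case: j' => [[k|i]|k] // kK; rewrite (leq_trans kK)// leq_maxr.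
pose l1 : seq (nat + 'I_n) := [seq inl k | k <- index_iota 0 K] ++
  [seq inr i | i <- enum 'I_n].
have l1P j : inl j \in l -> j \in l1.
  move=> /KP; rewrite mem_cat; case: j => [k kK|i _].
    by rewrite map_f// mem_index_iota.
  by rewrite [X in _ || X]map_f ?orbT ?mem_enum.
have ul1 : uniq l1.
  rewrite cat_uniq; apply/and3P; split.
  - by rewrite map_inj_uniq ?iota_uniq// => ? ? [].
  - by apply/hasPn => _ /mapP[i _ ->]; apply/negP => /mapP[].
  - by rewrite map_inj_uniq ?enum_uniq// => ? ? [].
pose l2 : seq (nat + 'I_n + nat) := [seq inl j | j <- l1] ++ [seq inr k | k <- index_iota 0 K].
have ul2 : uniq l2.
  rewrite cat_uniq; apply/and3P; split.
  - by rewrite map_inj_uniq// => ? ? [].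
  - by apply/hasPn => _ /mapP[i _ ->]; apply/negP => /mapP[].
  - by rewrite map_inj_uniq ?iota_uniq// => ? ? [].
have l2P j : j \in l -> j \in l2.
  rewrite mem_cat; case: j => [j /l1P jl1|k /KP kK].
    by rewrite map_f.
  by rewrite [X in _ || X]map_f ?orbT// mem_index_iota.
have -> : cylinder l B = cylinder l2 C.
  apply/seteqP; split => f Bf j jl; first by rewrite /C; case: ifPn => // /Bf.
  by have := Bf j (l2P j jl); rewrite /C jl.
rewrite [LHS](iY ul2 mC) big_cat !big_map/=.
pose phi (j : nat + 'I_n) : option 'I_n * nat :=
  match j with inl k => (None, k) | inr i => (Some i, 0%N) end.
have phi_inj : injective phi by move=> [k|i] [k'|i'] //= [->].
pose E : set (pathspace R (option 'I_n * nat)) :=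
  [set f | forall j, j \in l1 -> C (inl j) (f (phi j))].
pose CE (c : option 'I_n * nat) := match c with
  | (None, k) => C (inl (inl k)) | (Some i, 0%N) => C (inl (inr i)) | _ => setT end.
have mCE c : measurable (CE c) by case: c => -[i|] [|k] /=.
have CEE j : CE (phi j) = C (inl j) by case: j.
have EE : E = cylinder [seq phi j | j <- l1] CE.
  apply/seteqP; split => f Ef; first by move=> _ /mapP[j jl ->]; rewrite CEE; exact: Ef.
  by move=> j jl; rewrite -CEE; apply: Ef; exact: map_f.
have -> : (queue_input blocked \o joint X) @^-1` cylinder l2 C =
    joint X @^-1` (E `&` [set f | forall k, (k < K)%N -> C (inr k) (recorded f k)]).
  apply/seteqP; split => w; last first.
    move=> [Ew Dw] j; rewrite mem_cat => /orP[|] /mapP[].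
      by move=> [k|i] jl -> /=; have := Ew _ jl.
    by move=> k; rewrite mem_index_iota => kK -> /=; exact: Dw.
  move=> Cw; split => [j jl|k kK].
    have := Cw (inl j); rewrite mem_cat map_f// => /(_ isT).
    by case: (j).
  by have := Cw (inr k); rewrite mem_cat [X in _ || X]map_f ?orbT ?mem_index_iota// => /(_ isT).
have mE : measurable E by rewrite EE; exact: measurable_cylinder.
have iE i m : insensitive (Some i, m.+1) E.
  move=> f g fg Ef j jl; rewrite -fg; first exact: Ef.
  by case: (j) => [k|i']; apply/eqP; case.
rewrite [RHS](recorded_iid K mE iE (fun k => mC (inr k))).
congr (_ * _); last by apply: eq_bigr => k _; exact/esym/Yp.
rewrite EE.
have uphi : uniq [seq phi j | j <- l1] by rewrite map_inj_uniq.
rewrite [RHS](iX uphi mCE) big_map; apply: eq_bigr => j _.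
by rewrite CEE; case: j => [k|i]; [exact: Ya|exact: Yr].
Qed.

End coupling.

Local Open Scope ereal_scope.

(** * Residual lives *)

Section lifetime.
Context {R : realType}.

Definition alive d (T : measurableType d) (X : T -> R) :
    set (measurableTypeR R * T) :=
  [set z | (0 <= z.1 < X z.2)%R].

Lemma measurable_alive d (T : measurableType d) (X : T -> R) :
  measurable_fun setT X -> measurable (alive X).
Proof.
move=> mX; rewrite (_ : alive X =
   [set z : measurableTypeR R * T | (0 <= z.1)%R && (z.1 < X z.2)%R])//.
apply/measurable_boolP; apply: measurable_and.
  by apply: measurable_fun_ler => //; exact: measurable_fst.
apply: measurable_fun_ltr; first exact: measurable_fst.
by apply: measurableT_comp => //; exact: measurable_snd.
Qed.

Lemma product_alive d (T : measurableType d) (P : probability T R) (X : T -> R)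
    (B : set R) (S : set T) :
  measurable_fun setT X -> measurable B -> measurable S ->
  (lebesgue_measure \x P) (alive X `&` B `*` S) =
  \int[lebesgue_measure]_(y in B `&` `[0%R, +oo[) P ([set w | (y < X w)%R] `&` S).
Proof.
move=> mX mB mS; rewrite [LHS]/product_measure1 [RHS]integral_mkcond.
apply: eq_integral => y _; rewrite /= patchE.
case: ifPn => [/set_mem [By]|/negP yB]; last first.
  rewrite [X in P X](_ : _ = set0) ?measure0//.
  apply/seteqP; split => // w; rewrite /xsection/= inE => -[/= /andP[y0 _] [By Sw]].
  by apply: yB; apply/mem_set; split => //=; rewrite in_itv/= y0.
rewrite /= in_itv/= andbT => y0; congr (P _); apply/seteqP; split => w.
  by rewrite /xsection/= inE => -[/= /andP[_ yX] [_ Sw]].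
by move=> [/= yX Sw]; rewrite /xsection/= inE; split=> //; apply/andP.
Qed.

Context d0 (T0 : measurableType d0) (P0 : probability T0 R) (V : {RV P0 >-> R}).
Hypothesis V_ge0 : forall w, (0 <= V w)%R.
Hypothesis V_mean : P0.-integrable [set: T0] (EFin \o V).
Hypothesis V_neq0 : P0 [set w | V w = 0%R] = 0.

Notation mean := (fine 'E_P0[V]).

Lemma mean_fin : 'E_P0[V] = mean%:E.
Proof.
by rewrite fineK// expectation_def; exact: integrable_fin_num V_mean.
Qed.

Lemma mean_gt0 : (0 < mean)%R.
Proof.
rewrite -lte_fin -mean_fin lt_neqAle expectation_ge0// andbT eq_sym.
apply/negP => /eqP E0.
have : \int[P0]_w `|(EFin \o V) w| = 0.
  transitivity ('E_P0[V]); last exact: E0.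
  rewrite expectation_def; apply: eq_integral => w _ /=.
  by rewrite ger0_norm.
move/(ae_eq_integral_abs _ measurableT); rewrite /ae_eq.
have mV : measurable_fun setT (EFin \o V) by apply/measurable_EFinP; exact: measurable_funP.
move=> /(_ mV) [N [mN N0 subN]].
have mV0 : measurable [set w | V w = 0%R].
  exact: (measurable_preimageT (measurable_funP V) (measurable_set1 0%R)).
have : P0 [set: T0] <= 0.
  rewrite -[leRHS]adde0 -[X in X + _]N0 -V_neq0.
  apply: (le_trans _ (measureU2 _ _ _)) => //.
  apply: le_measure; rewrite ?inE//; first exact: measurableU.
  move=> w _; have [V0|V0] := eqVneq (V w) 0%R; [by right|left; apply: subN].
  by move=> /(_ I) /= [] /eqP; rewrite (negPf V0).
by rewrite probability_setT lee_fin ler10.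
Qed.

Lemma mean_inv_ge0 : (0 <= mean^-1)%R.
Proof. by rewrite invr_ge0 ltW// mean_gt0. Qed.

Lemma ccdfE y : P0 ([set w | (y < V w)%R] `&` setT) = ccdf V y.
Proof.
rewrite setIT /ccdf /distribution /pushforward; congr (P0 _).
by apply/seteqP; split => w /=; rewrite in_itv/= andbT.
Qed.

Lemma measurable_ccdf : measurable_fun setT (ccdf V).
Proof. exact: ccdf_measurable. Qed.

(** The residual life has density [ccdf V / mean], which is the law of a point
    chosen uniformly below a lifetime that is itself biased by its length.  The
    tails on [z >= 0] determine it because they already have mass one. *)
Lemma residual_law d (T : measurableType d) (P : probability T R)
    (Y : {RV P >-> R}) (B : set R) : residual_life V Y -> measurable B ->
  P (Y @^-1` B) = (mean^-1)%:E *
    \int[lebesgue_measure]_(y in B `&` `[0%R, +oo[) ccdf V y.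
Proof.
move=> HY mB.
have mV : measurable_fun setT V by exact: measurable_funP.
have malive := measurable_alive mV.
pose m2 : {measure set (measurableTypeR R) -> \bar R} := mscale (NngNum mean_inv_ge0)
  (image_measure (mrestr (lebesgue_measure \x P0) malive)
    (@measurable_fst _ _ _ _)).
have m2E A : measurable A -> m2 A = (mean^-1)%:E *
    \int[lebesgue_measure]_(y in A `&` `[0%R, +oo[) ccdf V y.
  move=> mA; rewrite /m2 /= /mscale /= /pushforward /mrestr; congr (_ * _).
  transitivity ((lebesgue_measure \x P0) (alive V `&` A `*` setT)).
    by congr (product_measure1 _ _ _); apply/seteqP; split => z /=; tauto.
  by rewrite product_alive//; apply: eq_integral => y _; rewrite ccdfE.
have tail z : (0 <= z)%R -> P (Y @^-1` `]z, +oo[%classic) = m2 `]z, +oo[%classic.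
  move=> z0; rewrite m2E; last exact: measurable_itv.
  rewrite (_ : _ `&` _ = `]z, +oo[%classic); first exact: HY.
  apply/seteqP; split => [y []//|y /= zy]; split => //.
  by move: zy; rewrite /= !in_itv/= !andbT => /ltW; exact: le_trans.
have total : m2 `[0%R, +oo[%classic = 1.
  rewrite m2E; last exact: measurable_itv.
  by rewrite setIid -ge0_expectation_ccdf// mean_fin -EFinM mulVf// gt_eqF// mean_gt0.
have total0 : P (Y @^-1` `]0%R, +oo[%classic) = 1.
  rewrite tail// -total !m2E; try exact: measurable_itv.
  congr (_ * _); rewrite setIid (_ : _ `&` _ = `]0%R, +oo[%classic).
    by apply: integral_itv_obnd_cbnd; exact: measurable_funTS measurable_ccdf.
  apply/seteqP; split => [y []//|y /= zy]; split => //.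
  by move: zy; rewrite /= !in_itv/= !andbT => /ltW.
rewrite -m2E//.
pose m1 := image_measure (T' := measurableTypeR R) P (measurable_funP Y).
rewrite -[LHS]/(m1 B).
pose rays (k : nat) : set R := `](- k%:R)%R, +oo[%classic.
have rayI : setI_closed (@RGenOInfty.G R).
  move=> _ _ [z ->] [z' ->]; exists (Num.max z z').
  apply/seteqP; split => y /=; rewrite !in_itv/= !andbT gt_max.
    by move=> [-> ->].
  by move=> /andP.
have raysG k : RGenOInfty.G (rays k) by exists (- k%:R)%R.
have rays_cover : \bigcup_k rays k = setT.
  apply/seteqP; split => // y _.
  exists (Num.trunc (- y)).+1 => //=; rewrite /rays/= in_itv/= andbT ltrNl.
  exact: truncnS_gt.
have m12 : forall A, RGenOInfty.G A -> m1 A = m2 A.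
  move=> _ [z ->]; have [z0|z0] := leP 0%R z; first exact: tail.
  transitivity (1 : \bar R).
    have mz r : measurable (Y @^-1` `]r, +oo[%classic).
      by apply: measurable_preimageT; [exact: measurable_funP|exact: measurable_itv].
    apply/eqP; rewrite eq_le probability_le1//= -total0.
    apply: le_measure; rewrite ?inE//.
    by move=> w /=; rewrite !in_itv/= !andbT; exact: lt_trans.
  rewrite -total !m2E; try exact: measurable_itv.
  congr (_ * _); rewrite setIid (_ : _ `&` _ = `[0%R, +oo[%classic)//.
  apply/seteqP; split => [y []//|y /= y0]; split => //.
  by move: y0; rewrite /= !in_itv/= !andbT; exact: lt_le_trans.
have m1fin k : m1 (rays k) < +oo.
  apply: (@le_lt_trans _ _ 1); last exact: ltry.
  rewrite -[leLHS]/(P (Y @^-1` rays k)); apply: probability_le1.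
  by apply: measurable_preimageT; [exact: measurable_funP|exact: measurable_itv].
have mE := RGenOInfty.measurableE R.
exact: (@measure_unique _ R (measurableTypeR R) _ _ mE rayI raysG rays_cover m1 m2 m12 m1fin B mB).
Qed.

End lifetime.

(** * The equilibrium law seen from a typical life *)

Section palm.
Context {R : realType}.

Definition restart (y : R) (z : pathspace R nat) : pathspace R nat :=
  fun j => if j is 0%N then y else z j.

Lemma measurable_restart d (T : measurableType d) (y : T -> R) (z : T -> pathspace R nat) :
  measurable_fun setT y -> measurable_fun setT z ->
  measurable_fun setT (fun w => restart (y w) (z w)).
Proof.
move=> my mz; apply: measurable_pathspace => -[|j]//=.
exact: (measurableT_comp (measurable_coord j.+1) mz).
Qed.

Lemma mutually_independent_reindex d (T : measurableType d) (P : probability T R)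
    (I J : eqType) (X : I -> {RV P >-> R}) (phi : J -> I) :
  injective phi -> mutually_independent X -> mutually_independent (X \o phi).
Proof.
move=> phi_inj iX s B us mB.
pose B' i := if pselect (exists j, phi j = i) is left h then B (sval (cid h)) else setT.
have B'E j : B' (phi j) = B j.
  rewrite /B'; case: pselect => [h|]; last by case; exists j.
  by case: (cid h) => j' /= /phi_inj ->.
have mB' i : measurable (B' i) by rewrite /B'; case: pselect.
have us' : uniq [seq phi j | j <- s] by rewrite map_inj_uniq.
have := iX _ _ us' mB'; rewrite big_map.
under eq_bigr do rewrite B'E.
move=> <-; congr (P _); apply/seteqP; split => w h.
  by move=> _ /mapP[j js ->]; rewrite B'E; exact: h.
by move=> j js; rewrite -B'E; apply: h; exact: map_f.
Qed.

Context d0 (T0 : measurableType d0) (P0 : probability T0 R) (V : {RV P0 >-> R}).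
Hypothesis V_ge0 : forall w, (0 <= V w)%R.
Hypothesis V_mean : P0.-integrable [set: T0] (EFin \o V).
Hypothesis V_neq0 : P0 [set w | V w = 0%R] = 0.
Notation mean := (fine 'E_P0[V]).

Context d (T : measurableType d) (P : probability T R) (x : nat -> {RV P >-> R}).
Hypothesis ix : mutually_independent x.
Hypothesis eqx : equilibrium_laws V x.

Definition lives (w : T) : pathspace R nat := fun j => x j.+1 w.

Lemma measurable_lives : measurable_fun setT lives.
Proof. by apply: measurable_pathspace => j; exact: measurable_funP. Qed.

(** The first gap may be seen as a uniform point below the length-biased life
    [x 1], which turns the law of an equilibrium renewal process into Lebesgue
    measure times an i.i.d. sequence: a form on which time can be reversed. *)
Lemma palm (A : set (pathspace R nat)) : measurable A ->
  P (joint x @^-1` A) = (mean^-1)%:E *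
   (lebesgue_measure \x P)
     (alive (x 1%N) `&` [set q | A (restart q.1 (lives q.2))]).
Proof.
move=> mA; have [resx samex] := eqx.
pose f (q : measurableTypeR R * T) := restart q.1 (lives q.2).
have mf : measurable_fun setT f.
  apply: measurable_restart; first exact: measurable_fst.
  by apply: measurableT_comp; [exact: measurable_lives|exact: measurable_snd].
have malive := measurable_alive (measurable_funP (x 1%N)).
have PT : P setT < +oo by rewrite probability_setT ltry.
rewrite -[X in P X]setTI.
apply: (eq_law_pathspace (P' := (lebesgue_measure \x P)) (mean_inv_ge0 V_ge0 V_mean V_neq0)
  (measurable_joint x) mf measurableT malive PT _ mA).
move=> {A mA} l B ul mB; rewrite setTI.
pose l0 := [seq j <- l | j != 0%N].
pose B0 := if 0%N \in l then B 0%N else setT.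
have mB0 : measurable B0 by rewrite /B0; case: ifP.
have B0E y : (0%N \in l -> B 0%N y) <-> B0 y.
  by rewrite /B0; case: ifPn => [_|/negP h]; split=> // h'; exact: h'.
pose C j := if j == 0%N then B0 else B j.
have mC j : measurable (C j) by rewrite /C; case: ifP.
have ul0 : uniq (0%N :: l0) by rewrite /= mem_filter eqxx filter_uniq.
have -> : joint x @^-1` cylinder l B =
    [set w | forall i, i \in 0%N :: l0 -> C i (x i w)].
  apply/seteqP; split => w h i.
    rewrite inE /C; case: (eqVneq i 0%N) => [->_|i0 /=]; first by apply/B0E => l0'; exact: h.
    by rewrite mem_filter => /andP[_]; exact: h.
  move=> il; have := h i; rewrite inE mem_filter il andbT orbN /C => /(_ isT).
  by case: (eqVneq i 0%N) il => [-> il /B0E|//]; apply.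
rewrite [LHS](ix ul0 mC) big_cons {1}/C eqxx.
pose S := [set w | forall j, j \in l0 -> B j (x j.+1 w)].
pose p := \prod_(j <- l0) P (x j @^-1` B j).
pose D y j := if j == 1%N then `]y, +oo[%classic else B j.-1.
have mD y j : measurable (D y j) by rewrite /D; case: ifP => // _; exact: measurable_itv.
have ul1 : uniq (1%N :: [seq j.+1 | j <- l0]).
  rewrite /= map_inj_uniq ?filter_uniq// ?andbT; last by move=> ? ? [].
  by apply/mapP => -[j]; rewrite mem_filter => /andP[j0 _] [j1]; rewrite -j1 in j0.
have SE y : P ([set w | (y < x 1%N w)%R] `&` S) = ccdf V y * p.
  transitivity (P [set w | forall i, i \in 1%N :: [seq j.+1 | j <- l0] -> D y i (x i w)]).
    congr (P _); apply/seteqP; split => w.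
      move=> [yx Sw] i; rewrite inE => /predU1P[->|/mapP[j jl ->]].
        by rewrite /D /= in_itv/= yx.
      rewrite /D eqSS; case: eqP => [j0|_]; last exact: Sw.
      by move: jl; rewrite mem_filter j0.
    move=> h; split.
      by have := h 1%N; rewrite mem_head /D /= in_itv/= andbT; apply.
    move=> j jl; have := h j.+1; rewrite inE map_f ?orbT// => /(_ isT).
    rewrite /D eqSS; case: eqP => // j0.
    by move: jl; rewrite mem_filter j0.
  rewrite [LHS](ix ul1 (mD y)) big_cons /D eqxx; congr (_ * _).
    by have /esym := samex 0%N `]y, +oo[%classic (measurable_itv _).
  rewrite big_map; apply: eq_big_seq => j; rewrite mem_filter => /andP[j0 _].
  rewrite eqSS (negPf j0) /=; case: j j0 => // j _.
  by transitivity (P0 (V @^-1` B j.+1)); [apply/esym|]; exact: samex.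
transitivity ((mean^-1)%:E *
  (lebesgue_measure \x P) (alive (x 1%N) `&` B0 `*` S)); last first.
  congr (_ * product_measure1 _ _ _); congr (_ `&` _).
  apply/seteqP; split => -[y w].
    move=> [/= B0y Sw] [|j] jl /=; first by apply/B0E: jl.
    by apply: Sw; rewrite mem_filter.
  move=> h; split=> /=; first by apply/B0E => l0'; exact: (h 0%N).
  by move=> [|j]; rewrite mem_filter//= => jl; exact: (h j.+1).
have mS : measurable S.
  rewrite (_ : S = lives @^-1` cylinder l0 B)//.
  by apply: measurable_preimageT; [exact: measurable_lives|exact: measurable_cylinder].
rewrite product_alive//.
under eq_integral do rewrite SE.
rewrite ge0_integralZr//.
- rewrite muleA -(residual_law _ _ _ resx mB0)//; congr (_ * _).
  apply: eq_big_seq => j; rewrite /C mem_filter => /andP[/negPf -> _].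
  by [].
- by apply: measurableI => //; exact: measurable_itv.
- exact: measurable_funTS (measurable_ccdf V).
- by apply: prode_ge0 => j _.
Qed.

End palm.

(** * Time reversal of an equilibrium renewal process *)

Section product_measures.
Context {R : realType}.
Notation leb := (@lebesgue_measure R).

Lemma lebesgue_measure_reflect (s : R) (A : set R) : measurable A ->
  leb ((fun y => s - y)%R @^-1` A) = leb A.
Proof.
have mrefl : measurable_fun setT
    ((fun y => s - y)%R : measurableTypeR R -> measurableTypeR R).
  by apply: measurable_funB => //; exact: measurable_cst.
move=> mA; suff H X : ocitv X -> leb X = image_measure leb mrefl X.
  exact/esym/(lebesgue_measure_unique H).
move=> [[a b]] _ <-.
rewrite /image_measure /= /pushforward (_ : _ @^-1` _ = `[s - b, s - a[%classic)%R.
  rewrite /= !lebesgue_measure_itv/= !lte_fin ltrD2l ltrN2; case: ifP => // _.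
  by rewrite -!EFinD; congr (_%:E); lra.
apply/seteqP; split => y /=; rewrite !in_itv/= => /andP[ay yb]; apply/andP; split; lra.
Qed.

Context d (T : measurableType d) (P : probability T R).

Lemma product_measure_swap (Z : set (measurableTypeR R * T)) : measurable Z ->
  (leb \x P) Z = \int[P]_w leb (ysection Z w).
Proof.
move=> mZ; apply: (@product_measure_unique _ _ _ _ R leb P (leb \x^ P)) => //.
by move=> A B mA mB; exact: product_measure2E.
Qed.

Lemma eq_product_measure d' (T' : measurableType d') (f g : T -> T')
    (Z : set (measurableTypeR R * T')) :
  (forall A, measurable A -> P (f @^-1` A) = P (g @^-1` A)) -> measurable Z ->
  (leb \x P) [set q | Z (q.1, f q.2)] = (leb \x P) [set q | Z (q.1, g q.2)].
Proof.
move=> fg mZ; apply: eq_integral => y _ /=.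
have := fg _ (measurable_xsection y mZ).
congr (_ = _); congr (P _); apply/seteqP; split => w; rewrite /xsection/=;
  by rewrite !inE.
Qed.

(** Reflecting the first coordinate at a point that depends on the second one
    preserves the product with Lebesgue measure. *)
Lemma product_measure_reflect (c : T -> R) (Z Z' : set (measurableTypeR R * T)) :
  measurable Z -> measurable Z' ->
  (forall y w, Z' (y, w) <-> Z (c w - y, w)%R) ->
  (leb \x P) Z' = (leb \x P) Z.
Proof.
move=> mZ mZ' ZZ'; rewrite !product_measure_swap//; apply: eq_integral => w _.
rewrite -[RHS](lebesgue_measure_reflect (c w)); last exact: measurable_ysection.
by congr (leb _); apply/seteqP; split => y; rewrite /ysection/= !inE => /ZZ'.
Qed.

End product_measures.

Section reversal.
Context {R : realType}.
Variable t : R.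

(** For non-negative gaps: exactly [k] events up to time [t]. *)
Definition straddle (k : nat) : set (pathspace R nat) :=
  [set s | if k is k'.+1 then (event_time s k' <= t < event_time s k)%R
           else (t < event_time s 0)%R].

(** Keeps the first [k] events of [s].  The gap [t + 1] pushes all later events
    beyond [t], so nothing after the window is remembered. *)
Definition truncate (k : nat) (s : pathspace R nat) : pathspace R nat :=
  fun j => if (j < k)%N then s j else if j == k then (t + 1)%R else 1%R.

(** The same for the time-reversed process: its first event is the last one of
    [s] before [t], and the gaps follow in reverse order. *)
Definition reverse (k : nat) (s : pathspace R nat) : pathspace R nat :=
  truncate k (fun j => if j is 0%N then (t - event_time s k.-1)%R else s (k - j)%N).

Lemma measurable_event_time_path k :
  measurable_fun setT (fun s : pathspace R nat => event_time s k).
Proof. by apply: measurable_event_time => j; exact: measurable_coord. Qed.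

Lemma measurable_straddle k : measurable (straddle k).
Proof.
case: k => [|k].
  apply/measurable_boolP; apply: measurable_fun_ltr => //.
  exact: measurable_event_time_path.
apply/measurable_boolP; apply: measurable_and.
  by apply: measurable_fun_ler => //; exact: measurable_event_time_path.
by apply: measurable_fun_ltr => //; exact: measurable_event_time_path.
Qed.

Lemma measurable_truncate k :
  measurable_fun setT (truncate k).
Proof.
apply: measurable_pathspace => j; rewrite /truncate.
case: (j < k)%N; first exact: measurable_coord.
by case: (j == k); exact: measurable_cst.
Qed.

Lemma measurable_reverse k :
  measurable_fun setT (reverse k).
Proof.
apply: (measurableT_comp (measurable_truncate k)).
apply: measurable_pathspace => -[|j]; last exact: measurable_coord.
by apply: measurable_funB => //; exact: measurable_event_time_path.
Qed.

(** Reads the lives [0, ..., k] backwards.  Fixing the other indices makes it an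
    involution, under which an i.i.d. sequence is invariant. *)
Definition flip (k : nat) (j : nat) : nat := if (j <= k)%N then (k - j)%N else j.

Lemma flipK k : involutive (flip k).
Proof. by rewrite /flip => j; case: (leqP j k) => jk; [rewrite leq_subr; lia|rewrite leqNgt jk]. Qed.

Lemma event_time_restart (y : R) (z : pathspace R nat) k :
  event_time (restart y z) k = (y + \sum_(j < k) z j.+1)%R.
Proof. by rewrite /event_time big_ord_recl. Qed.

Lemma sum_flip (z : nat -> R) k :
  (\sum_(j < k) z (flip k.+1 j.+1) = \sum_(j < k) z j.+1)%R.
Proof.
rewrite (reindex_inj rev_ord_inj); apply: eq_bigr => j _ /=.
congr (z _); rewrite /flip; have := ltn_ord j; case: ifP; lia.
Qed.

Lemma reverse_restart (y : R) (z : pathspace R nat) k :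
  reverse k.+1 (restart y z) =
  truncate k.+1 (restart (t - event_time (restart y z) k)%R (z \o flip k.+1)).
Proof.
apply/funext => -[|j] //=; rewrite /reverse /truncate; case: ifP => // jk.
have -> : (k.+1 - j.+1 = (k - j.+1).+1)%N by lia.
by rewrite /= /flip leqW//; congr z; lia.
Qed.

Context d0 (T0 : measurableType d0) (P0 : probability T0 R) (V : {RV P0 >-> R}).
Hypothesis V_ge0 : forall w, (0 <= V w)%R.
Hypothesis V_mean : P0.-integrable [set: T0] (EFin \o V).
Hypothesis V_neq0 : P0 [set w | V w = 0%R] = 0.

Context d (T : measurableType d) (P : probability T R) (x : nat -> {RV P >-> R}).
Hypothesis ix : mutually_independent x.
Hypothesis eqx : equilibrium_laws V x.

(** By [palm], given [k.+1] events the law is that of i.i.d. lives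
    [z 0, ..., z k.+1] with a Lebesgue point [y] below [z 0] such that
    [t - y - (z 1 + ... + z k)] lies below [z k.+1].  Reversing time amounts to
    exchanging these two points and reading the lives backwards. *)
Lemma reversal_straddle k (A : set (pathspace R nat)) : measurable A ->
  P (joint x @^-1` (straddle k `&` truncate k @^-1` A)) =
  P (joint x @^-1` (straddle k `&` reverse k @^-1` A)).
Proof.
move=> mA.
have mt : measurable (truncate k @^-1` A) by apply: measurable_preimageT => //; exact: measurable_truncate.
have mr : measurable (reverse k @^-1` A) by apply: measurable_preimageT => //; exact: measurable_reverse.
have mL := measurable_straddle k.
case: k => [//|k] in mt mr mL *.
rewrite !(palm V_ge0 V_mean V_neq0 ix eqx); try exact: measurableI.
congr (_ * _).
pose c (z : pathspace R nat) : R := (t - \sum_(j < k) z j.+1)%R.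
pose zone (B : set (pathspace R nat)) : set (measurableTypeR R * pathspace R nat) :=
  [set q | (0 <= q.1 < q.2 0%N)%R /\ (straddle k.+1 `&` B) (restart q.1 q.2)].
have zoneE B y z : zone B (y, z) <->
    [/\ (0 <= y < z 0%N)%R, (0 <= c z - y < z k.+1)%R & B (restart y z)].
  rewrite /zone /straddle /= !event_time_restart big_ord_recr/= /c.
  by split=> [[-> [/andP[h1 h2] Bz]]|[-> /andP[h1 h2] Bz]];
    (do ?split) => //; apply/andP; split; lra.
have mzone B : measurable B -> measurable (zone B).
  move=> mB; apply: measurableI; first exact: (measurable_alive (measurable_coord 0%N)).
  have mres : measurable_fun [set: measurableTypeR R * pathspace R nat]
      (fun q => restart q.1 q.2).
    by apply: measurable_restart; [exact: measurable_fst|exact: measurable_snd].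
  by apply: (measurable_preimageT mres); exact: measurableI.
have mlives := measurable_lives x.
have mpair (f : T -> pathspace R nat) : measurable_fun setT f ->
    measurable_fun [set: measurableTypeR R * T] (fun q => (q.1, f q.2)).
  move=> mf; apply: measurable_fun_pair; first exact: measurable_fst.
  by apply: measurableT_comp => //; exact: measurable_snd.
have mflip : measurable_fun setT (fun w => lives x w \o flip k.+1 : pathspace R nat).
  by apply: measurable_pathspace => j; exact: measurable_funP.
have law_flip B : measurable B ->
    P (lives x @^-1` B) = P ((fun w => lives x w \o flip k.+1) @^-1` B).
  have [_ samex] := eqx.
  have iS : injective S by move=> ? ? [].
  have i1 := mutually_independent_reindex iS ix.
  have i2 := mutually_independent_reindex (can_inj (flipK k.+1)) i1.
  move=> mB; apply: (eq_law_independent i1 i2) => // j C mC.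
  by transitivity (P0 (V @^-1` C)); [apply/esym|]; exact: samex.
transitivity ((lebesgue_measure \x P)
   [set q | zone (truncate k.+1 @^-1` A) (q.1, lives x q.2)]).
  by congr (product_measure1 _ _ _); apply/seteqP; split => q.
rewrite (eq_product_measure law_flip); last exact: mzone.
transitivity ((lebesgue_measure \x P)
   [set q | zone (reverse k.+1 @^-1` A) (q.1, lives x q.2)]); last first.
  by congr (product_measure1 _ _ _); apply/seteqP; split => q.
apply/esym; apply: (@product_measure_reflect _ _ _ P (c \o lives x)).
- by apply: (measurable_preimageT (mpair _ mflip)); exact: mzone.
- by apply: (measurable_preimageT (mpair _ mlives)); exact: mzone.
move=> y w /=; rewrite !zoneE.
have cE : c (lives x w \o flip k.+1) = c (lives x w).
  by rewrite /c; congr (_ - _)%R; exact: sum_flip.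
rewrite cE /= reverse_restart event_time_restart.
have -> : (t - (y + \sum_(j < k) lives x w j.+1) = c (lives x w) - y)%R.
  by rewrite /c; lra.
have -> : flip k.+1 0 = k.+1 by rewrite /flip.
have -> : flip k.+1 k.+1 = 0%N by rewrite /flip leqnn subnn.
by rewrite subKr; split=> -[].
Qed.

End reversal.

(** * Regular paths *)

Section almost_sure.
Context {R : realType} d (T : measurableType d) (P : probability T R).

Lemma almost_sureI (A B : set T) : measurable A -> measurable B ->
  P A = 1 -> P B = 1 -> P (A `&` B) = 1.
Proof. by move=> mA mB PA PB; rewrite measure_eq1I. Qed.

Lemma almost_sure_bigcap (K : countType) (F : K -> set T) :
  (forall k, measurable (F k)) -> (forall k, P (F k) = 1) ->
  P (\bigcap_k F k) = 1.
Proof.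
move=> mF PF; have mc k : measurable (~` F k) by exact: measurableC.
have PFc k : P (~` F k) = 0 by rewrite probability_setC// PF subee.
pose G j := if @pickle_inv K j is Some k then ~` F k else set0.
have GE : \bigcap_k F k = ~` \bigcup_j G j.
  apply/seteqP; split => w.
    by move=> Fw [j _]; rewrite /G; case: pickle_inv => // k; apply; exact: Fw.
  move=> nG k _; apply: contrapT => nF; apply: nG; exists (pickle k) => //.
  by rewrite /G pickleK_inv.
have mG j : measurable (G j) by rewrite /G; case: pickle_inv.
rewrite GE probability_setC; last exact: bigcupT_measurable.
suff -> : P (\bigcup_j G j) = 0 by rewrite sube0.
apply: measure_negligible; first exact: bigcupT_measurable.
apply: negligible_bigcup => j; exists (G j); split => //.
by rewrite /G; case: pickle_inv => [k|]; [exact: PFc|exact: measure0].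
Qed.

Lemma almost_sureS (A B : set T) : measurable A -> measurable B ->
  A `<=` B -> P A = 1 -> P B = 1.
Proof.
move=> mA mB AB PA; apply/eqP; rewrite eq_le probability_le1//= -PA.
by apply: le_measure; rewrite ?inE.
Qed.

End almost_sure.

Section regular.
Context {R : realType}.

(** On these paths events do not accumulate, so counts are finite, and none
    occurs at time [0], so counts start from [0]. *)
Definition regular : set (pathspace R nat) :=
  [set s | [/\ (0 < s 0%N)%R, forall k, (0 <= s k)%R &
    forall m, exists k, (m < event_time s k)%R]].

(** A condition stronger than divergence of the event times whose probability is
    within reach of finite-dimensional computations. *)
Definition recurrent (e : R) : set (pathspace R nat) :=
  [set s | forall a : nat, exists k, (e < s (a + k)%N)%R].

Lemma recurrent_regular e (s : pathspace R nat) : (0 < e)%R -> (0 < s 0%N)%R ->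
  (forall k, 0 <= s k)%R -> recurrent e s -> regular s.
Proof.
move=> e0 s0 sp rec; split => // m.
have grow N : exists k, (e *+ N <= event_time s k)%R.
  elim: N => [|N [k kN]].
    by exists 0%N; rewrite event_time0 mulr0n ltW.
  have [j ej] := rec k.+1; exists (k.+1 + j)%N.
  rewrite addSn event_timeS mulrSr lerD//; last by rewrite -addSn ltW.
  by apply: (le_trans kN); apply: le_event_time => //; exact: leq_addr.
have [k hk] := grow (Num.trunc (m / e)).+1; exists k; apply: lt_le_trans hk.
by rewrite -mulr_natl -ltr_pdivrMr//; exact: truncnS_gt.
Qed.

Lemma measurable_recurrent e : measurable (recurrent e).
Proof.
rewrite (_ : recurrent e = \bigcap_a \bigcup_k [set s | (e < s (a + k)%N)%R]).
  apply: bigcapT_measurable => a; apply: bigcupT_measurable => k.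
  by apply/measurable_boolP; apply: measurable_fun_ltr => //; exact: measurable_coord.
apply/seteqP; split => s h a; first by move=> _; have [k] := h a; exists k.
by have [k _] := h a I; exists k.
Qed.

Definition nonneg : set (pathspace R nat) :=
  [set s | (0 < s 0%N)%R] `&` \bigcap_k [set s | (0 <= s k)%R].

Lemma measurable_nonneg : measurable nonneg.
Proof.
apply: measurableI.
  by apply/measurable_boolP; apply: measurable_fun_ltr => //; exact: measurable_coord.
apply: bigcapT_measurable => k.
by apply/measurable_boolP; apply: measurable_fun_ler => //; exact: measurable_coord.
Qed.

Lemma measurable_regular : measurable regular.
Proof.
rewrite (_ : regular = nonneg `&` \bigcap_m \bigcup_k [set s | (m%:R < event_time s k)%R]).
  apply: measurableI; first exact: measurable_nonneg.
  apply: bigcapT_measurable => m; apply: bigcupT_measurable => k.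
  by apply/measurable_boolP; apply: measurable_fun_ltr => //;
    exact: measurable_event_time_path.
apply/seteqP; split => [s [s0 sp sm]|s [[s0 sp] sm]].
  by split=> [|m _]; [split=> // k _; exact: sp|have [k] := sm m%:R; exists k].
split => // [k|m]; first exact: sp k I.
have [k _ h] := sm (Num.trunc m).+1 I; exists k; apply: lt_trans h.
exact: truncnS_gt.
Qed.

Context d0 (T0 : measurableType d0) (P0 : probability T0 R) (V : {RV P0 >-> R}).
Hypothesis V_ge0 : forall w, (0 <= V w)%R.
Hypothesis V_mean : P0.-integrable [set: T0] (EFin \o V).
Hypothesis V_neq0 : P0 [set w | V w = 0%R] = 0.

Lemma exceeds_often : exists2 e : R, (0 < e)%R & P0 (V @^-1` `]-oo, e]) < 1.
Proof.
apply: contrapT => h.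
have all1 k : P0 (V @^-1` `]-oo, (k.+1%:R^-1)%R]) = 1.
  apply/eqP; rewrite eq_le probability_le1/=; last first.
    by apply: measurable_preimageT; [exact: measurable_funP|exact: measurable_itv].
  rewrite leNgt; apply/negP => lt1; apply: h; exists (k.+1%:R^-1)%R.
    by rewrite invr_gt0.
  exact: lt1.
have := almost_sure_bigcap (P := P0) _ all1.
have -> : \bigcap_k (V @^-1` `]-oo, (k.+1%:R^-1)%R]) = [set w | V w = 0%R].
  apply/seteqP; split => w /=.
    move=> Vk; apply/eqP; rewrite eq_le V_ge0 andbT leNgt; apply/negP => V0.
    have := Vk (Num.trunc (V w)^-1) I; rewrite /= in_itv/= leNgt => /negP; apply.
    by rewrite invf_plt ?posrE//; exact: truncnS_gt.
  by move=> V0 k _; rewrite /= in_itv/= (V0 : V w = 0%R).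
rewrite V_neq0 => /(_ _)/esym/eqP; rewrite -[1]/(1%:E) -[0]/(0%:E) eqe oner_eq0 => H.
suff : false by []; apply: H => k.
by apply: measurable_preimageT; [exact: measurable_funP|exact: measurable_itv].
Qed.

Context d (T : measurableType d) (P : probability T R) (x : nat -> {RV P >-> R}).
Hypothesis ix : mutually_independent x.
Hypothesis eqx : equilibrium_laws V x.

(** The probability that [j] consecutive gaps do not exceed [e] is at most the
    [j]-th power of a number below one. *)
Lemma recurrent_as e : P0 (V @^-1` `]-oo, e]) < 1 -> P (joint x @^-1` recurrent e) = 1.
Proof.
move=> e1; have [_ samex] := eqx.
have mq : measurable (`]-oo, e]%classic : set R) by exact: measurable_itv.
have mVq : measurable (V @^-1` `]-oo, e]).
  by apply: measurable_preimageT => //; exact: measurable_funP.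
pose q := fine (P0 (V @^-1` `]-oo, e])).
have qE : P0 (V @^-1` `]-oo, e]) = q%:E by rewrite fineK// fin_num_measure.
have q0 : (0 <= q)%R by rewrite fine_ge0.
have q1 : (q < 1)%R by rewrite -lte_fin -qE.
pose E a := [set w | forall k, (x (a + k)%N w <= e)%R].
have mxle k : measurable [set w | (x k w <= e)%R].
  by apply/measurable_boolP; apply: measurable_fun_ler.
have mE a : measurable (E a).
  rewrite (_ : E a = \bigcap_k [set w | (x (a + k)%N w <= e)%R]).
    exact: bigcapT_measurable.
  by apply/seteqP; split => w h k; [move=> _|]; exact: h.
have Eq a j : P (E a) <= (q ^+ j)%:E.
  have ua : uniq (iota a.+1 j) by exact: iota_uniq.
  have := ix ua (fun _ => mq) => iE.
  apply: (@le_trans _ _ (P [set w | forall i, i \in iota a.+1 j ->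
      `]-oo, e]%classic (x i w)])).
    apply: le_measure; rewrite ?inE//.
      rewrite (_ : [set w | _] = joint x @^-1` cylinder (iota a.+1 j) (fun=> `]-oo, e]%classic))//.
      by apply: measurable_preimageT; [exact: measurable_joint|exact: measurable_cylinder].
    move=> w Ew i; rewrite mem_iota => /andP[ai _] /=; rewrite in_itv/=.
    by rewrite -(subnKC (ltnW ai)); exact: Ew.
  rewrite iE (eq_big_seq (fun=> q%:E)); last first.
    move=> i; rewrite mem_iota => /andP[+ _]; case: i => // i _ /=.
    by rewrite -qE; exact/esym/(samex i _ mq).
  rewrite big_const_seq count_predT size_iota.
  elim: j {ua iE} => [|j IH]; first by rewrite expr0.
  by rewrite iterS exprS EFinM; apply: lee_wpmul2l; rewrite ?lee_fin.
have E0 a : P (E a) = 0.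
  apply/eqP; rewrite eq_le measure_ge0 andbT leNgt; apply/negP => Ea.
  have Efin : P (E a) \is a fin_num by rewrite fin_num_measure.
  have : (0 < fine (P (E a)))%R by rewrite -lte_fin fineK.
  have : (fun j => q ^+ j)%R @ \oo --> (0%R : R) by apply: cvg_expr; rewrite ger0_norm.
  move=> /cvgrPdist_lt h r0; have [j _ /(_ j (leqnn _))] := h _ r0.
  rewrite sub0r normrN ger0_norm ?exprn_ge0// -lte_fin fineK// ltNge.
  by rewrite Eq.
have -> : joint x @^-1` recurrent e = \bigcap_a ~` E a.
  apply/seteqP; split => w h a.
    by move=> _ Ea; have [k] := h a; rewrite ltNge Ea.
  have := h a I => /existsNP[k /negP]; rewrite -ltNge => ek.
  by exists k.
apply: almost_sure_bigcap => a; first exact: measurableC.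
by rewrite probability_setC// E0 sube0.
Qed.

Lemma regular_as : P (joint x @^-1` regular) = 1.
Proof.
have [resx samex] := eqx.
have mx k (B : set R) : measurable B -> measurable (x k @^-1` B).
  by move=> mB; apply: measurable_preimageT => //; exact: measurable_funP.
have x_gt0 : P (x 0%N @^-1` `]0%R, +oo[) = 1.
  have := resx 0%R (lexx _); rewrite /ccdf /distribution /pushforward => ->.
  rewrite -/(ccdf V) integral_itv_obnd_cbnd; last exact: measurable_funTS (measurable_ccdf V).
  rewrite -ge0_expectation_ccdf// [X in _ * X](mean_fin V_mean) -EFinM mulVf//.
  by rewrite gt_eqF// mean_gt0.
have x_ge0 k : P (x k @^-1` `[0%R, +oo[) = 1.
  case: k => [|k].
    apply: (almost_sureS _ _ _ x_gt0); try exact: mx (measurable_itv _).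
    by move=> w /=; rewrite !in_itv/= !andbT => /ltW.
  have /esym := samex k `[0%R, +oo[%classic (measurable_itv _).
  rewrite {1}/distribution /pushforward => ->.
  rewrite /distribution /pushforward (_ : _ @^-1` _ = setT) ?probability_setT//.
  by apply/seteqP; split => // w _ /=; rewrite in_itv/= V_ge0.
have [e e0 /recurrent_as rec] := exceeds_often.
have mjoint (A : set (pathspace R nat)) : measurable A -> measurable (joint x @^-1` A).
  by apply: measurable_preimageT; exact: measurable_joint.
have nonneg_as : P (joint x @^-1` nonneg) = 1.
  rewrite (_ : _ @^-1` _ = x 0%N @^-1` `]0%R, +oo[ `&` \bigcap_k (x k @^-1` `[0%R, +oo[)).
    apply: almost_sureI => //; first exact: mx (measurable_itv _).
      by apply: bigcapT_measurable => k; exact: mx (measurable_itv _).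
    by apply: almost_sure_bigcap => // k; exact: mx (measurable_itv _).
  apply/seteqP; split => w [h0 h].
    by split=> [|k _] /=; rewrite in_itv/= andbT//; exact: h.
  split=> [|k _] /=; first by move: h0; rewrite /= in_itv/= andbT.
  by have := h k I; rewrite /= in_itv/= andbT.
apply: (almost_sureS (A := joint x @^-1` (nonneg `&` recurrent e))).
- by apply: mjoint; apply: measurableI; [exact: measurable_nonneg|exact: measurable_recurrent].
- by apply: mjoint; exact: measurable_regular.
- by move=> w [[w0 wp] wr]; apply: recurrent_regular wr => // k; exact: wp.
- by apply: almost_sureI => //; apply: mjoint;
    [exact: measurable_nonneg|exact: measurable_recurrent].
Qed.

End regular.

Section window.
Context {R : realType}.
Variable t : R.
Hypothesis t_ge0 : (0 <= t)%R.

Lemma straddle_le k (s : pathspace R nat) j : (forall i, 0 <= s i)%R ->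
  straddle t k s -> (event_time s j <= t)%R = (j < k)%N.
Proof.
move=> sp; have mono := le_event_time sp.
case: k => [|k] /=.
  by move=> st; rewrite ltn0 leNgt (lt_le_trans st)//; exact: mono.
case/andP => kt tk; rewrite ltnS; case: leqP => jk.
  by rewrite (le_trans _ kt)//; exact: mono.
by rewrite leNgt (lt_le_trans tk)//; exact: mono.
Qed.

Lemma straddle_ex (s : pathspace R nat) : regular s -> exists k, straddle t k s.
Proof.
move=> [_ sp sM]; have [N NP] := finite_events t sp sM; exists N.
case: N NP => [|k] NP /=; first by rewrite ltNge NP.
by rewrite NP ltnSn ltNge NP ltnn.
Qed.

Lemma straddle_uniq k k' (s : pathspace R nat) : regular s ->
  straddle t k s -> straddle t k' s -> k = k'.
Proof.
move=> [_ sp _] sk sk'.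
have E j : (j < k)%N = (j < k')%N by rewrite -!(straddle_le _ sp).
apply/eqP; rewrite eqn_leq; apply/andP.
by split; rewrite leqNgt; [rewrite E ltnn|rewrite -E ltnn].
Qed.

(** The number of events up to [t].  The default [0] concerns paths with
    infinitely many of them, a null set. *)
Definition rank (s : pathspace R nat) : nat :=
  if pselect (exists k, (t < event_time s k)%R) is left h then ex_minn h else 0%N.

Lemma rank_straddle k (s : pathspace R nat) : regular s -> straddle t k s -> rank s = k.
Proof.
move=> [_ sp sM] sk; rewrite /rank; case: pselect => [h|]; last by case; exact: sM.
case: ex_minnP => m; rewrite ltNge (straddle_le _ sp sk) -leqNgt => km.
move=> /(_ k); rewrite ltNge (straddle_le _ sp sk) ltnn => /(_ isT) mk.
by apply/eqP; rewrite eqn_leq mk.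
Qed.

Lemma measurable_rank_fiber k : measurable [set s | rank s = k].
Proof.
pose E j := [set s : pathspace R nat | (event_time s j <= t)%R].
have mE j : measurable (E j).
  by apply/measurable_boolP; apply: measurable_fun_ler => //; exact: measurable_event_time_path.
rewrite (_ : [set s | _] =
  ((~` E k) `&` \bigcap_j (if (j < k)%N then E j else setT)) `|`
  (if k == 0%N then \bigcap_j E j else set0)).
  apply: measurableU; last first.
    by case: ifP => // _; exact: bigcapT_measurable.
  apply: measurableI; first exact: measurableC.
  by apply: bigcapT_measurable => j; case: ifP.
apply/seteqP; split => s.
  move=> /= <-; rewrite /rank; case: pselect => [h|h]; last first.
    by right=> j _; rewrite /E/= leNgt; apply/negP => tj; apply: h; exists j.
  left; case: ex_minnP => m tm mmin; split; first by rewrite /E/= leNgt tm.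
  move=> j _; case: ifPn => // jm; rewrite /E/= leNgt; apply/negP => /mmin.
  by rewrite leqNgt jm.
move=> [[/= /negP]|].
  rewrite -ltNge => tk h; rewrite /rank; case: pselect => [h'|]; last by case; exists k.
  case: ex_minnP => m tm mmin; apply/eqP; rewrite eqn_leq mmin//= leqNgt.
  apply/negP => mk; have := h m I; rewrite mk /E/= leNgt.
  by rewrite tm.
case: eqP => [->|//] h; rewrite /= /rank; case: pselect => // -[j tj].
by have := h j I; rewrite /E/= leNgt tj.
Qed.

Definition truncated (s : pathspace R nat) : pathspace R nat := truncate t (rank s) s.
Definition reversed (s : pathspace R nat) : pathspace R nat := reverse t (rank s) s.

Lemma measurable_truncated : measurable_fun setT truncated.
Proof.
apply: (measurable_switch (F := truncate t)) => k; first exact: measurable_rank_fiber.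
exact: measurable_truncate.
Qed.

Lemma measurable_reversed : measurable_fun setT reversed.
Proof.
apply: (measurable_switch (F := reverse t)) => k; first exact: measurable_rank_fiber.
exact: measurable_reverse.
Qed.

Lemma event_time_truncate k (s : pathspace R nat) j : (j < k)%N ->
  event_time (truncate t k s) j = event_time s j.
Proof.
move=> jk; apply: eq_bigr => i _; rewrite /truncate ifT//.
by apply: leq_ltn_trans jk; rewrite -ltnS.
Qed.

Lemma event_time_truncate_late k (s : pathspace R nat) j : (k <= j)%N ->
  (forall i, 0 <= s i)%R -> (t < event_time (truncate t k s) j)%R.
Proof.
move=> kj sp.
have tp i : (0 <= truncate t k s i)%R.
  by rewrite /truncate; do 2 case: ifP => // _; rewrite addr_ge0.
apply: (@lt_le_trans _ _ (event_time (truncate t k s) k)); last exact: le_event_time.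
rewrite /event_time big_ord_recr/= {2}/truncate ltnn eqxx.
apply: (@lt_le_trans _ _ (t + 1)%R); first by rewrite ltrDl.
by rewrite lerDr sumr_ge0.
Qed.

Lemma renewals_truncated (s : pathspace R nat) sg : regular s -> (sg <= t)%R ->
  renewals (truncated s) sg = renewals s sg.
Proof.
move=> rs sgt; have [k sk] := straddle_ex rs.
rewrite /truncated (rank_straddle rs sk); have [_ sp _] := rs.
rewrite /renewals !(@eseries_nat _ _ k).
- congr (_%:R%:E); apply: eq_bigr => j _.
  by rewrite event_time_truncate.
- move=> j kj; suff : (sg < event_time s j)%R by rewrite ltNge => /negPf ->; rewrite andbF.
  by apply: (le_lt_trans sgt); rewrite ltNge (straddle_le _ sp sk) -leqNgt.
- move=> j kj; have := event_time_truncate_late kj sp.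
  by move=> /(le_lt_trans sgt); rewrite ltNge => /negPf ->; rewrite andbF.
Qed.

Lemma event_time_reverse k (s : pathspace R nat) j : (j < k)%N ->
  event_time (reverse t k s) j = (t - event_time s (k - j.+1))%R.
Proof.
rewrite /reverse => jk; rewrite event_time_truncate//.
elim: j jk => [|j IH] jk; first by rewrite event_time0 subn1.
rewrite event_timeS IH; last exact: ltnW.
have -> : (k - j.+1 = (k - j.+2).+1)%N by lia.
by rewrite event_timeS; lra.
Qed.

Lemma renewals_reversed (s : pathspace R nat) sg : regular s -> (0 <= sg <= t)%R ->
  renewals (reversed s) sg = events s (t - sg) t.
Proof.
move=> rs /andP[sg0 sgt]; have [k sk] := straddle_ex rs.
rewrite /reversed (rank_straddle rs sk); have [_ sp _] := rs.
have sle := straddle_le _ sp sk.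
rewrite (events_fin _ sle) /renewals (@eseries_nat _ _ k); last first.
  move=> j kj; suff : (sg < event_time (reverse t k s) j)%R.
    by rewrite ltNge => /negPf ->; rewrite andbF.
  apply: (le_lt_trans sgt).
  rewrite (_ : reverse t k s = truncate t k (fun j => if j is 0%N then
      Num.max 0 (t - event_time s k.-1) else s (k - j)%N)%R).
    apply: event_time_truncate_late => // -[|i] //; first by rewrite le_max lexx.
  apply/funext => -[|i]//; rewrite /reverse /truncate; case: ifP => // k0.
  by apply/esym/max_r; rewrite subr_ge0 sle; case: k k0 {sk sle kj}.
congr (_%:R%:E); rewrite [RHS](reindex_inj rev_ord_inj); apply: eq_bigr => j _ /=.
rewrite event_time_reverse//; congr nat_of_bool.
have -> : (0 <= t - event_time s (k - j.+1))%R.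
  by rewrite subr_ge0 sle; have := ltn_ord j; lia.
by rewrite /= lerBlDr lerBlDl addrC.
Qed.

Context d0 (T0 : measurableType d0) (P0 : probability T0 R) (V : {RV P0 >-> R}).
Hypothesis V_ge0 : forall w, (0 <= V w)%R.
Hypothesis V_mean : P0.-integrable [set: T0] (EFin \o V).
Hypothesis V_neq0 : P0 [set w | V w = 0%R] = 0.

Context d (T : measurableType d) (P : probability T R) (x : nat -> {RV P >-> R}).
Hypothesis ix : mutually_independent x.
Hypothesis eqx : equilibrium_laws V x.

(** Time reversal on [0, t], which [reversal_straddle] gives for each number of
    events, put together over all these numbers. *)
Lemma reversible (A : set (pathspace R nat)) : measurable A ->
  P (joint x @^-1` (truncated @^-1` A)) = P (joint x @^-1` (reversed @^-1` A)).
Proof.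
move=> mA.
have mj (B : set (pathspace R nat)) : measurable B -> measurable (joint x @^-1` B).
  by apply: measurable_preimageT; exact: measurable_joint.
have reg := regular_as V_ge0 V_mean V_neq0 ix eqx.
have mreg := @measurable_regular R.
pose C k := joint x @^-1` (regular `&` straddle t k).
have mC k : measurable (C k).
  by apply: mj; apply: measurableI => //; exact: measurable_straddle.
have uC k k' w : C k w -> C k' w -> k = k'.
  by move=> [rw sk] [_]; exact: straddle_uniq.
have PC : P (\bigcup_k C k) = 1.
  rewrite -reg; congr (P _); apply/seteqP; split => [w [k _ []]//|w rw].
  by have [k sk] := straddle_ex rw; exists k.
have mtr : measurable (truncated @^-1` A).
  by apply: measurable_preimageT => //; exact: measurable_truncated.
have mrv : measurable (reversed @^-1` A).
  by apply: measurable_preimageT => //; exact: measurable_reversed.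
rewrite (measure_partition mC (mj _ mtr) uC PC).
rewrite (measure_partition mC (mj _ mrv) uC PC).
apply: eq_eseriesr => j _; case: pickle_inv => // k.
have step (g : nat -> pathspace R nat -> pathspace R nat) :
    (forall k, measurable_fun setT (g k)) ->
    P (joint x @^-1` [set s | A (g (rank s) s)] `&` C k) =
    P (joint x @^-1` (straddle t k `&` g k @^-1` A)).
  move=> mg; rewrite -[RHS](measure_eq1I _ (mj _ mreg) reg); last first.
    apply: mj; apply: measurableI; first exact: measurable_straddle.
    exact: measurable_preimageT.
  congr (P _); apply/seteqP; split => w.
    by move=> [+ [rw sk]]; rewrite /= (rank_straddle rw sk).
  by move=> [[sk gA] rw]; split=> //; rewrite /= (rank_straddle rw sk).
rewrite (step (truncate t)); last by move=> i; exact: measurable_truncate.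
rewrite (step (reverse t)); last by move=> i; exact: measurable_reverse.
exact: (reversal_straddle _ V_ge0 V_mean V_neq0 ix eqx).
Qed.

End window.

(** * Independent blocks *)

Section blocks.
Context {R : realType} {C : finType}.

Definition block (f : pathspace R (C * nat)) (c : C) : pathspace R nat :=
  fun k => f (c, k).

Lemma measurable_block c : measurable_fun setT (block^~ c).
Proof. by apply: measurable_pathspace => k; exact: measurable_coord. Qed.

Context d (T : measurableType d) (P : probability T R) (X : C * nat -> {RV P >-> R}).
Hypothesis iX : mutually_independent X.

Let mX (A : set (pathspace R (C * nat))) : measurable A -> measurable (joint X @^-1` A).
Proof. by apply: measurable_preimageT; exact: measurable_joint. Qed.

Lemma independent_block c (D : set (pathspace R (C * nat))) (S : set (pathspace R nat)) :
  measurable D -> (forall k, insensitive (c, k) D) -> measurable S ->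
  P (joint X @^-1` (D `&` block^~ c @^-1` S)) =
  P (joint X @^-1` D) * P (joint X @^-1` (block^~ c @^-1` S)).
Proof.
move=> mD iD mS.
have finD : P (joint X @^-1` D) \is a fin_num by rewrite fin_num_measure//; exact: mX.
have D0 : (0 <= fine (P (joint X @^-1` D)))%R by rewrite fine_ge0.
have PDoo : P (joint X @^-1` D) < +oo by rewrite ltey_eq finD.
have mb : measurable_fun setT (block^~ c \o joint X).
  by apply: measurableT_comp; [exact: measurable_block|exact: measurable_joint].
have split_cyl (D' : set (pathspace R (C * nat))) (l : seq nat) (B : nat -> set R) :
    measurable D' -> (forall k, insensitive (c, k) D') -> uniq l ->
    (forall k, measurable (B k)) ->
    P (joint X @^-1` (D' `&` block^~ c @^-1` cylinder l B)) =
    P (joint X @^-1` D') * \prod_(k <- l) P (X (c, k) @^-1` B k).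
  move=> mD' iD' + mB; elim: l => [_|k l IH /=].
    rewrite big_nil mule1 (_ : _ @^-1` cylinder _ _ = setT) ?setIT//.
    by apply/seteqP; split.
  move=> /andP[kl ul]; rewrite big_cons muleCA -IH// muleC.
  rewrite -independent_insensitive//.
  - congr (P _); apply/seteqP; split => w.
      move=> [Dw cw]; split; last exact: (cw k (mem_head _ _)).
      by split=> // i il; apply: (cw i); rewrite inE il orbT.
    move=> [[Dw cw] Bw]; split=> // i; rewrite inE => /predU1P[->//|].
    exact: cw.
  - apply: measurableI => //; apply: measurable_preimageT; first exact: measurable_block.
    exact: measurable_cylinder.
  - move=> f g fg [Df cf]; split; first exact: iD' fg Df.
    move=> i il; have := cf i il; rewrite /block fg//.
    by apply: contraNneq kl => -[<-].
have := eq_law_pathspace (P := P) (P' := P) D0 mb mb (mX mD) measurableT PDoo.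
rewrite (fineK finD) => H.
rewrite preimage_setI; have -> : joint X @^-1` (block^~ c @^-1` S) =
  (block^~ c \o joint X) @^-1` S by [].
rewrite H// ?setTI// => l B ul mB; rewrite setTI.
transitivity (P (joint X @^-1` (D `&` block^~ c @^-1` cylinder l B))); first by [].
rewrite split_cyl//; congr (_ * _).
have iT k : insensitive (c, k) (@setT (pathspace R (C * nat))) by [].
have := split_cyl _ _ _ measurableT iT ul mB.
by rewrite setTI preimage_setT probability_setT mul1e => <-.
Qed.

Lemma blocks_prod (l : seq C) (S : C -> set (pathspace R nat)) : uniq l ->
  (forall c, measurable (S c)) ->
  P (joint X @^-1` [set f | forall c, c \in l -> S c (block f c)]) =
  \prod_(c <- l) P (joint X @^-1` (block^~ c @^-1` S c)).
Proof.
move=> + mS; have mb c : measurable (block^~ c @^-1` S c).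
  by apply: measurable_preimageT => //; exact: measurable_block.
have ml l' : measurable [set f | forall c, c \in l' -> S c (block f c)].
  rewrite (_ : [set f | _] = \bigcap_(c in [set` l']) (block^~ c @^-1` S c)).
    by apply: fin_bigcap_measurable.
  by apply/seteqP; split.
elim: l => [_|c l IH /= /andP[cl ul]].
  rewrite big_nil (_ : [set f | _] = setT) ?preimage_setT ?probability_setT//.
  by apply/seteqP; split.
rewrite big_cons -IH// muleC -independent_block//.
- congr (P (_ @^-1` _)); apply/seteqP; split => f.
    move=> Sf; split; last exact/Sf/mem_head.
    by move=> c' c'l; apply: Sf; rewrite inE c'l orbT.
  by move=> [Sf Sc] c'; rewrite inE => /predU1P[->//|]; exact: Sf.
- move=> k f g fg Sf c' c'l; have := Sf c' c'l; rewrite (_ : block f c' = block g c')//.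
  apply/funext => i; apply: fg; apply: contraNneq cl => -[<- _].
  by [].
Qed.

Definition blockwise (phi : pathspace R nat -> pathspace R nat)
    (f : pathspace R (C * nat)) : pathspace R (C * nat) :=
  fun j => phi (block f j.1) j.2.

Lemma measurable_blockwise phi : measurable_fun setT phi ->
  measurable_fun setT (blockwise phi).
Proof.
move=> mphi; apply: measurable_pathspace => -[c k].
have mc : measurable_fun setT (fun f => phi (block f c)).
  by apply: measurableT_comp => //; exact: measurable_block.
exact: (measurableT_comp (measurable_coord k) mc).
Qed.

(** Independence makes the joint law a function of the laws of the blocks; this
    extends the reversal of one renewal process to all of them at once. *)
Lemma eq_law_blockwise (phi psi : pathspace R nat -> pathspace R nat) :
  measurable_fun setT phi -> measurable_fun setT psi ->
  (forall c A, measurable A ->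
    P (joint X @^-1` (block^~ c @^-1` (phi @^-1` A))) =
    P (joint X @^-1` (block^~ c @^-1` (psi @^-1` A)))) ->
  forall A, measurable A ->
    P (joint X @^-1` (blockwise phi @^-1` A)) =
    P (joint X @^-1` (blockwise psi @^-1` A)).
Proof.
move=> mphi mpsi eq_phi A mA.
have mbw chi : measurable_fun setT chi -> measurable_fun setT (blockwise chi \o joint X).
  by move=> mchi; apply: measurableT_comp; [exact: measurable_blockwise|exact: measurable_joint].
have PT : P setT < +oo by rewrite probability_setT ltry.
have := eq_law_pathspace (P := P) (P' := P) (@ler01 R) (mbw _ mphi) (mbw _ mpsi)
  measurableT measurableT PT.
suff H (l : seq (C * nat)) (B : C * nat -> set R) : uniq l -> (forall i, measurable (B i)) ->
    P (setT `&` (blockwise phi \o joint X) @^-1` cylinder l B) =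
    1 * P (setT `&` (blockwise psi \o joint X) @^-1` cylinder l B).
  by move=> /(_ H A mA); rewrite !setTI mul1e.
move=> {A mA} _ mB; rewrite !setTI mul1e.
pose S c := cylinder [seq j.2 | j <- l & j.1 == c] (fun k => B (c, k)).
have mS c : measurable (S c) by exact: measurable_cylinder.
have E chi : (blockwise chi \o joint X) @^-1` cylinder l B =
    joint X @^-1` [set f | forall c, c \in enum C -> (chi @^-1` S c) (block f c)].
  apply/seteqP; split => w h.
    move=> c _ k /mapP[[c' k']]; rewrite mem_filter => /= /andP[/eqP -> jl] ->.
    exact: (h (c, k')).
  move=> [c k] jl; apply: (h c (mem_enum _ _)).
  by apply/mapP; exists (c, k) => //; rewrite mem_filter eqxx.
have mpre (chi : pathspace R nat -> pathspace R nat) c : measurable_fun setT chi -> measurable (chi @^-1` S c).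
  by move=> mchi; exact: measurable_preimageT.
have ue := enum_uniq C.
rewrite !E [LHS](blocks_prod ue (fun c => mpre _ c mphi)).
rewrite [RHS](blocks_prod ue (fun c => mpre _ c mpsi)).
by apply: eq_bigr => c _; exact: eq_phi.
Qed.

End blocks.

(** * Measurability of the bound *)

Section suprema.
Context {R : realType}.

Lemma le_events (x : nat -> R) al be be' : (be <= be')%R ->
  events x al be <= events x al be'.
Proof.
move=> bb'; apply: lee_nneseries => [k _ _|k _]; rewrite lee_fin//.
rewrite ler_nat; case: (leP al) => //= _.
by case: (leP _ be) => // /le_trans ->.
Qed.

Lemma last_event (x : nat -> R) (al s : R) N : (0 <= al <= s)%R ->
  exists r, [/\ r = al \/ exists k, r = event_time x k, (al <= r <= s)%R &
    forall k, (k < N)%N -> (event_time x k <= s)%R -> (event_time x k <= r)%R].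
Proof.
move=> /andP[al0 als]; elim: N => [|N [r [rE /andP[alr rs] rmax]]].
  by exists al; split=> //; [left|rewrite lexx].
have [/andP[rN Ns]|] := boolP (r < event_time x N <= s)%R.
  exists (event_time x N); split; first by right; exists N.
    by rewrite (le_trans alr (ltW rN)).
  move=> k; rewrite ltnS leq_eqVlt => /predU1P[->//|kN ks].
  exact: le_trans (rmax _ kN ks) (ltW rN).
move=> h; exists r; split=> //; first by rewrite alr.
move=> k; rewrite ltnS leq_eqVlt => /predU1P[->|]; last exact: rmax.
by move=> Ns; rewrite leNgt; apply: contra h => ->.
Qed.

(** The excess of a counting function over a non-decreasing one can only grow
    at the events that are counted, whatever accumulation points these have.
    Hence the supremum over a continuum reduces to one over a sequence, which
    makes it measurable. *)
Lemma sup_at_events (x : nat -> R) (B : R -> \bar R) (al : R) (J : set R) :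
  (0 <= al)%R -> J al -> (forall s, J s -> al <= s)%R ->
  (forall s r, J s -> (al <= r <= s)%R -> J r) ->
  (forall s, 0 <= B s) -> (forall r s, (r <= s)%R -> B r <= B s) ->
  ereal_sup [set renewals x s - B s | s in J] =
  maxe (renewals x al - B al)
    (esups (fun k => if `[< J (event_time x k) >]
       then renewals x (event_time x k) - B (event_time x k) else -oo) 0%N).
Proof.
move=> al0 Jal alJ convJ B0 Bmono; apply/eqP; rewrite eq_le; apply/andP; split; last first.
  rewrite ge_max; apply/andP; split; first by apply: ereal_sup_ubound; exists al.
  apply: ge_ereal_sup => _ [k _ <-]; case: asboolP => Jk; last exact: leNye.
  by apply: ereal_sup_ubound; exists (event_time x k).
apply: ge_ereal_sup => _ [s Js <-].
have [Boo|Bfin] := eqVneq (B s) +oo.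
  by rewrite Boo (_ : _ - +oo = -oo) ?leNye//; case: (renewals x s).
have {}Bfin : B s \is a fin_num by rewrite ge0_fin_numE// lt_neqAle Bfin leey.
rewrite leeBlDr//; apply: lime_le; first exact: is_cvg_nneseries.
near=> N.
have als : (0 <= al <= s)%R by rewrite al0 alJ.
have [r [rE /andP[alr rs] rmax]] := last_event x N als.
rewrite -leeBlDr//.
apply: (@le_trans _ _ (renewals x r - B r)); last first.
  have Jr : J r by apply: convJ Js _; rewrite alr.
  rewrite le_max; case: rE => [->|[k rk]]; apply/orP; [by left|right].
  apply: ereal_sup_ubound; exists k => //.
  by rewrite -rk asboolT.
apply: leeB; last exact: Bmono.
apply: le_trans (nneseries_lim_ge N _); last by [].
rewrite big_nat [leRHS]big_nat; apply: lee_sum => k /andP[_ kN].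
rewrite lee_fin ler_nat.
case: (boolP (0 <= event_time x k <= s)%R) => // /andP[-> ks].
by rewrite rmax.
Unshelve. all: end_near. Qed.

Variable n : nat.

Lemma excess_ext (c c' : option 'I_n -> R -> \bar R) (delta : R) (J : set R) eta :
  (0 <= delta)%R ->
  (forall j s, `[0%R, delta]%classic s \/ J s -> c j s = c' j s) ->
  excess c delta J eta = excess c' delta J eta.
Proof.
move=> d0 cc'; rewrite /excess; congr maxe.
  congr ereal_sup; apply/seteqP; split => _ [s Js <-]; exists s => //;
    rewrite cc'; try (by left); congr (_ - _);
    by apply: eq_bigr => i _; rewrite cc'//; left.
congr (_ + _); last first.
  by apply: eq_bigr => i _; apply: cc'; left; rewrite /= in_itv/= d0 lexx.
congr ereal_sup; apply/seteqP; split => _ [s Js <-]; exists s => //;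
  rewrite cc'; try (by right); congr (_ - _);
  by apply: eq_bigr => i _; rewrite cc'//; right.
Qed.

Lemma idle_ext (c c' : option 'I_n -> R -> \bar R) (delta : R) eta :
  (forall j, c j delta = c' j delta) -> idle c delta eta = idle c' delta eta.
Proof. by move=> cc'; apply: eq_bigr => i _; rewrite cc'. Qed.

Lemma le_excess (c : option 'I_n -> R -> \bar R) (delta : R) (J J' : set R) eta :
  J `<=` J' -> excess c delta J eta <= excess c delta J' eta.
Proof.
move=> JJ'; rewrite /excess ge_max !le_max lexx/=; apply/orP; right.
by apply: leeD2r; apply: ereal_sup_le => _ [s Js <-]; exists s => //; exact: JJ'.
Qed.

Context d (T : measurableType d).
Variables (u : T -> nat -> R) (v : T -> 'I_n -> nat -> R).
Hypothesis mu : forall k, measurable_fun setT (u^~ k).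
Hypothesis mv : forall i k, measurable_fun setT (fun w => v w i k).

Lemma measurable_forward j (s : T -> R) : measurable_fun setT s ->
  measurable_fun setT (fun w => forward (u w) (v w) j (s w)).
Proof.
move=> ms; case: j => [i|] /=.
  by apply: (measurable_events (x := fun w => v w i)) => //; exact: measurable_cst.
by apply: measurable_events => //; exact: measurable_cst.
Qed.

Lemma measurable_sum_forward (I : pred 'I_n) (s : T -> R) : measurable_fun setT s ->
  measurable_fun setT (fun w => \sum_(i < n | I i) forward (u w) (v w) (Some i) (s w)).
Proof.
move=> ms; under eq_fun do rewrite big_mkcond.
apply: emeasurable_sum => i; case: (I i); last exact: measurable_cst.
exact: measurable_forward.
Qed.

Lemma measurable_sup (I : pred 'I_n) (al : R) (J : set R) : measurable J ->
  (0 <= al)%R -> J al -> (forall s, J s -> al <= s)%R ->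
  (forall s r, J s -> (al <= r <= s)%R -> J r) ->
  measurable_fun setT (fun w => ereal_sup
    [set forward (u w) (v w) None s -
         \sum_(i < n | I i) forward (u w) (v w) (Some i) s | s in J]).
Proof.
move=> mJ al0 Jal alJ convJ.
pose B w s := \sum_(i < n | I i) forward (u w) (v w) (Some i) s.
have mB (s : T -> R) : measurable_fun setT s -> measurable_fun setT (fun w => B w (s w)).
  exact: measurable_sum_forward.
have B0 w s : 0 <= B w s by apply: sume_ge0 => i _; exact: events_ge0.
have Bm w r s : (r <= s)%R -> B w r <= B w s.
  by move=> rs; apply: lee_sum => i _; exact: le_events.
have supE w := sup_at_events (u w) al0 Jal alJ convJ (B0 w) (Bm w).
rewrite (_ : (fun w => _) = fun w => maxe (renewals (u w) al - B w al)
    (esups (fun k => if `[< J (event_time (u w) k) >]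
       then renewals (u w) (event_time (u w) k) - B w (event_time (u w) k) else -oo) 0%N));
  last by apply/funext => w; exact: supE.
apply: measurable_maxe.
  apply: emeasurable_funB; last by apply: mB; exact: measurable_cst.
  exact: (measurable_forward None (measurable_cst _)).
apply: (measurable_fun_esups (f := fun k w => if `[< J (event_time (u w) k) >]
       then renewals (u w) (event_time (u w) k) - B w (event_time (u w) k) else -oo)).
move=> k; have mk : measurable_fun setT (fun w => event_time (u w) k).
  exact: measurable_event_time.
apply: measurable_fun_ifT; last exact: measurable_cst.
  apply/measurable_boolP; rewrite (_ : [set w | _] = (fun w => event_time (u w) k) @^-1` J).
    exact: measurable_preimageT.
  by apply/seteqP; split => w /= /asboolP.
apply: emeasurable_funB; last exact: mB.
exact: (measurable_forward None mk).
Qed.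

Lemma measurable_excess (delta : R) (J : set R) eta : measurable J ->
  (0 <= delta)%R -> J delta -> (forall s, J s -> delta <= s)%R ->
  (forall s r, J s -> (delta <= r <= s)%R -> J r) ->
  measurable_fun setT (fun w => excess (forward (u w) (v w)) delta J eta).
Proof.
move=> mJ d0 Jd dJ convJ; apply: measurable_maxe.
  apply: (@measurable_sup (fun i => (i < eta)%N) 0%R) => //=.
  - by rewrite in_itv/= lexx.
  - by move=> s; rewrite in_itv/= => /andP[].
  - by move=> s r; rewrite !in_itv/= => /andP[_ sd] /andP[-> rs]; exact: le_trans sd.
apply: emeasurable_funD; first exact: (@measurable_sup xpredT delta).
exact: (measurable_sum_forward (fun i => (eta <= i)%N) (measurable_cst _)).
Qed.

Lemma measurable_idle (delta : R) eta :
  measurable_fun setT (fun w => idle (forward (u w) (v w)) delta eta).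
Proof.
rewrite /idle; under eq_fun do rewrite big_mkcond.
apply: emeasurable_sum => i; case: (eta <= i)%N; last exact: measurable_cst.
apply/measurable_EFinP; apply: measurable_fun_natr; apply: measurable_nat_of_bool.
apply/measurable_boolP.
rewrite (_ : [set w | _] = (fun w => forward (u w) (v w) (Some i) delta) @^-1` [set 0]).
  apply: measurable_preimageT; last exact: emeasurable_set1.
  exact: (measurable_forward (Some i) (measurable_cst _)).
by apply/seteqP; split => w /= /eqP.
Qed.

End suprema.

(** * The queue is integer-valued *)

Section integrality.
Context {R : realType}.

Lemma fine_eseries_bool (b : nat -> bool) :
  exists m : nat, fine (\sum_(0 <= k <oo) (b k : nat)%:R%:E) = m%:R :> R.
Proof.
have [[N bN]|/forallNP inf] := pselect (exists N, forall k, (N <= k)%N -> ~~ b k).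
  exists (\sum_(k < N) b k)%N; rewrite (@eseries_nat _ _ N)// => k /bN.
  by move/negPf ->.
exists 0%N; rewrite (_ : \sum_(_ <= _ <oo) _ = +oo)//.
have large m : exists N, (m <= \sum_(k < N) b k)%N.
  elim: m => [|m [N mN]]; first by exists 0%N.
  have /existsNP[k /not_implyP[Nk /negP/negPn bk]] := inf N.
  exists k.+1; rewrite big_ord_recr/= bk addn1 ltnS (leq_trans mN)//.
  by rewrite -(subnKC Nk) big_split_ord leq_addr.
apply/eqyP => r r0; have [N rN] := large (Num.trunc r).+1.
apply: (@le_trans _ _ (\sum_(0 <= k < N) (b k : nat)%:R%:E)); last first.
  exact: nneseries_lim_ge.
rewrite sumEFin big_mkord -natr_sum lee_fin.
by apply: (le_trans (ltW (truncnS_gt r))); rewrite ler_nat.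
Qed.

Lemma number_in_system_nat n (a : nat -> R) (r : 'I_n -> R) (p : nat -> R) t :
  exists m : nat, number_in_system a r p t = m%:R.
Proof.
have [m mE] := fine_eseries_bool
  (fun k => (event_time a k <= t < departure_time a r p k)%R).
exists (\sum_(i < n) (t < r i)%R + m)%N.
by rewrite /number_in_system mE natrD natr_sum.
Qed.

(** For integer-valued processes an upper bound on the tails passes to the weak
    limit: the ray from [x] lies inside an open ray that contains the same
    integers. *)
Lemma weak_limit_tail d (T : measurableType d) (P : probability T R)
    (Y : R -> T -> R) (mu : probability R R) (x : R) (t0 : R) (M : \bar R) :
  (forall t, measurable_fun setT (Y t)) ->
  (forall t w, exists m : nat, Y t w = m%:R) -> (0 <= x)%R ->
  weakly_converges P Y mu ->
  (forall t, (t0 <= t)%R -> P [set w | (x <= Y t w)%R] <= M) ->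
  mu [set y | (x <= y)%R] <= M.
Proof.
move=> mY Ynat x0 wY PM.
have /ex_minnP[m xm mmin] : exists m : nat, (x <= m%:R)%R.
  by exists (Num.trunc x).+1; exact/ltW/truncnS_gt.
have cx : (m%:R - 1 < x)%R.
  case: m xm mmin => [|m] _ mmin; first by lra.
  rewrite ltNge; apply/negP => xm; have := mmin m; rewrite ltnn => mn.
  by suff : false by []; apply: mn; apply: le_trans xm _; rewrite -[m.+1]addn1 natrD addrK.
pose c : R := (m%:R - 1)%R.
have below (k : nat) : (k%:R < x)%R -> (k%:R <= c)%R.
  move=> kx; rewrite /c lerBrDr natr1 ler_nat ltnNge; apply/negP => mk.
  by have := lt_le_trans kx xm; rewrite ltr_nat ltnNge mk.
(* [f] vanishes up to [c], the integer preceding [m], and is one from [x] on; on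
   integers it is the indicator of the ray. *)
pose f (y : R) : R := (Num.max 0 (Num.min 1 ((y - c) / (x - c))))%R.
have xc0 : (0 < x - c)%R by rewrite subr_gt0.
have f0 y : (0 <= f y)%R by rewrite /f le_max lexx.
have f1 y : (f y <= 1)%R by rewrite /f ge_max ler01 ge_min lexx.
have fx y : (x <= y)%R -> f y = 1%R.
  move=> xy; rewrite /f min_l; first by rewrite max_r.
  by rewrite ler_pdivlMr// mul1r lerB.
have fc y : (y <= c)%R -> f y = 0%R.
  move=> yc; rewrite /f max_l// ge_min; apply/orP; right.
  by rewrite ler_pdivrMr// mul0r subr_le0.
have cf : continuous f.
  move=> y; have cg : {for y, continuous ((fun z => (z - c) / (x - c))%R : R -> R^o)}.
    by apply: cvgMl; apply: cvgB => //; exact: cvg_cst.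
  have k (a : R) : {for y, continuous ((fun=> a) : R -> R^o)} by exact: cvg_cst.
  exact: (continuous_max (k 0%R) (continuous_min (k 1%R) cg)).
have mf : measurable_fun setT f by exact: continuous_measurable_fun.
have bf : exists B : R, forall y, (`|f y| <= B)%R.
  by exists 1%R => y; rewrite ger0_norm.
have mray : measurable [set y : R | (x <= y)%R].
  by rewrite -set_itvcy; exact: measurable_itv.
apply: (@le_trans _ _ (\int[mu]_y (f y)%:E)).
  rewrite -[X in mu X <= _]setIT -(integral_indic _ measurableT)//.
  apply: ge0_le_integral => //.
  - by apply/measurable_EFinP; exact: measurable_indic.
  - exact/measurable_EFinP.
  - move=> y _; rewrite lee_fin indicE; case: (boolP (y \in _)) => // /set_mem /= xy.
    by rewrite fx.
apply: (closed_cvg (fun z : \bar R => z <= M) (@closed_ereal_ge_ereal _ M)) (wY f cf bf).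
near=> s; apply: (@le_trans _ _ (P [set w | (x <= Y s w)%R])); last first.
  by apply: PM; near: s; apply: nbhs_pinfty_ge; exact: num_real.
have mset : measurable [set w | (x <= Y s w)%R].
  by apply/measurable_boolP; exact: measurable_fun_ler.
rewrite -[X in _ <= P X]setIT -(integral_indic _ measurableT)//.
apply: ge0_le_integral => //.
- by move=> w _; rewrite lee_fin; exact: f0.
- by apply/measurable_EFinP; exact: measurableT_comp.
- by apply/measurable_EFinP; exact: measurable_indic.
move=> w _; rewrite lee_fin indicE; have [xY|Yx] := leP x (Y s w).
  by rewrite mem_set.
rewrite memNset/=; last by move=> /=; rewrite leNgt Yx.
have [k kE] := Ynat s w; rewrite kE fc//; apply: below.
by rewrite -kE.
Unshelve. all: end_near. Qed.

End integrality.

(** * The bound *)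

Section bound.
Context {R : realType} {n : nat}.

(** The event of the bound as a set of paths, to be compared for the renewal
    processes, their truncations and their reversals. *)
Definition exceeds (delta : R) (J : set R) (eta : nat) (x : R) :
    set (pathspace R (option 'I_n * nat)) :=
  [set f | let c := forward (arrival_gaps f) (service_gaps f) in
    (x - eta%:R)%:E <= excess c delta J eta + idle c delta eta].

Lemma measurable_exceeds delta (J : set R) eta x : measurable J ->
  (0 <= delta)%R -> J delta -> (forall s, J s -> delta <= s)%R ->
  (forall s r, J s -> (delta <= r <= s)%R -> J r) ->
  measurable (exceeds delta J eta x).
Proof.
move=> mJ d0 Jd dJ convJ.
rewrite -[X in measurable X]setTI; apply: emeasurable_fun_c_infty => //.
apply: emeasurable_funD.
  by apply: measurable_excess => // [k|i k];
    [exact: measurable_arrival_gaps|exact: measurable_service_gaps].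
by apply: measurable_idle => // [k|i k];
  [exact: measurable_arrival_gaps|exact: measurable_service_gaps].
Qed.

Definition regular_blocks : set (pathspace R (option 'I_n * nat)) :=
  \bigcap_c (block^~ c @^-1` regular).

Lemma measurable_regular_blocks : measurable regular_blocks.
Proof.
rewrite /regular_blocks; apply: fin_bigcap_measurable => // c _.
by apply: measurable_preimageT; [exact: measurable_block|exact: measurable_regular].
Qed.

(** The supremum includes time [0], at which regular paths have no event. *)
Lemma excess_ge0 f delta (J : set R) eta : (0 <= delta)%R -> regular_blocks f ->
  0 <= excess (forward (arrival_gaps f) (service_gaps f)) delta J eta.
Proof.
move=> d0 rf; rewrite le_max; apply/orP; left.
apply: ereal_sup_ubound; exists 0%R; first by rewrite /= in_itv/= lexx.
have none c : renewals (block f c) 0%R = 0.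
  apply: eseries0 => k _ _; have [f0 fp _] := rf c I.
  rewrite (_ : (_ <= _ <= _)%R = false)//; apply/negbTE; rewrite negb_and -!ltNge.
  apply/orP; right; apply: (lt_le_trans f0).
  by rewrite -event_time0; exact: le_event_time.
have -> : forward (arrival_gaps f) (service_gaps f) None 0%R = 0 by exact: (none None).
by rewrite big1 ?sube0// => i _; exact: (none (Some i)).
Qed.

Context d0 (T0 : measurableType d0) (P0 : probability T0 R) (U V : {RV P0 >-> R}).
Hypothesis U_ge0 : forall w, (0 <= U w)%R.
Hypothesis V_ge0 : forall w, (0 <= V w)%R.
Hypothesis U_mean : P0.-integrable [set: T0] (EFin \o U).
Hypothesis V_mean : P0.-integrable [set: T0] (EFin \o V).
Hypothesis U_neq0 : P0 [set w | U w = 0%R] = 0.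
Hypothesis V_neq0 : P0 [set w | V w = 0%R] = 0.

Context d2 (T2 : measurableType d2) (P2 : probability T2 R)
  (u : nat -> {RV P2 >-> R}) (v : 'I_n -> nat -> {RV P2 >-> R}).
Hypothesis HAN : independent_equilibrium_renewals U V u v.

Let X (j : option 'I_n * nat) : {RV P2 >-> R} :=
  if j.1 is Some i then v i j.2 else u j.2.

Let iX : mutually_independent X. Proof. by case: HAN. Qed.

Let mX (A : set (pathspace R (option 'I_n * nat))) : measurable A ->
  measurable (joint X @^-1` A).
Proof. by apply: measurable_preimageT; exact: measurable_joint. Qed.

Let iblock c : mutually_independent (fun k => X (c, k)).
Proof.
by apply: (mutually_independent_reindex (phi := fun k => (c, k)) _ iX) => k k' [].
Qed.

Lemma regular_blocks_as : P2 (joint X @^-1` regular_blocks) = 1.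
Proof.
have [eu ev _] := HAN.
rewrite (_ : _ @^-1` _ = \bigcap_c (joint X @^-1` (block^~ c @^-1` regular)))//.
apply: almost_sure_bigcap => c.
  by apply: mX; apply: measurable_preimageT; [exact: measurable_block|exact: measurable_regular].
case: c => [i|].
  exact: (regular_as V_ge0 V_mean V_neq0 (iblock (Some i)) (ev i)).
exact: (regular_as U_ge0 U_mean U_neq0 (iblock None) eu).
Qed.

Lemma reversible_blocks t A : measurable A ->
  P2 (joint X @^-1` (blockwise (truncated t) @^-1` A)) =
  P2 (joint X @^-1` (blockwise (reversed t) @^-1` A)).
Proof.
move: A; have [eu ev _] := HAN.
apply: eq_law_blockwise => //.
- exact: measurable_truncated.
- exact: measurable_reversed.
case=> [i|] A mA.
  have iv : mutually_independent (v i) := iblock (Some i).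
  exact: (reversible t V_ge0 V_mean V_neq0 iv (ev i) mA).
have iu : mutually_independent u := iblock None.
exact: (reversible t U_ge0 U_mean U_neq0 iu eu mA).
Qed.

Context d1 (T1 : measurableType d1) (P1 : probability T1 R)
  (a : nat -> {RV P1 >-> R}) (r : 'I_n -> {RV P1 >-> R}) (p : nat -> {RV P1 >-> R}).
Hypothesis HQ : GI_GI_n_primitives U V a r p.
Hypothesis n_gt0 : (0 < n)%N.

Notation Q t w := (number_in_system (fun k => a k w) (fun i => r i w) (fun k => p k w) t).

Lemma same_equilibrium_laws (W : {RV P0 >-> R}) (y : nat -> {RV P1 >-> R})
    (z : nat -> {RV P2 >-> R}) : (forall w, (0 <= W w)%R) ->
  P0.-integrable [set: T0] (EFin \o W) -> P0 [set w | W w = 0%R] = 0 ->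
  equilibrium_laws W y -> equilibrium_laws W z -> forall k, same_law (y k) (z k).
Proof.
move=> W0 Wm Wn [ry sy] [rz sz] [|k] B mB.
  rewrite /distribution /pushforward (residual_law W0 Wm Wn ry mB).
  by rewrite (residual_law W0 Wm Wn rz mB).
by rewrite -(sy k B mB) (sz k B mB).
Qed.

(** The bound read forward has the law of the bound read backward from [t],
    because both depend only on the events up to [t] and these are reversible;
    the latter bound dominates the queue path by path under the coupling. *)
Lemma tail_bound t x delta eta : (0 <= delta <= t)%R -> (eta <= n)%N ->
  P1 [set w | (x <= Q t w)%R] <= P2 (joint X @^-1` exceeds delta `[delta, t] eta x).
Proof.
move=> /andP[dl0 dlt] en; have t0 := le_trans dl0 dlt.
have [ea rr pp iY] := HQ; have [eu ev _] := HAN.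
set Y := (Z in mutually_independent Z) in iY.
pose bl := @late_block R n t delta eta.
have mbl i : measurable_fun setT (bl i).
  apply: measurable_and; first exact: measurable_cst.
  by apply: measurable_and; apply: measurable_fun_ler => //; exact: measurable_cst.
have mreg := measurable_regular_blocks.
have admitted K : P2 (\bigcup_c joint X @^-1` admission bl K c) = 1.
  apply: (almost_sureS (A := joint X @^-1` regular_blocks)).
  - exact: mX.
  - apply: countable_bigcupT_measurable => // c; apply: mX.
    exact: measurable_admission.
  - move=> w rw; have [] := @admission_cover R n bl n_gt0 K (joint X w) t.
    + by move=> i s ts; rewrite /bl /late_block !negb_and -!ltNge ts !orbT.
    + by move=> i k; have [_ + _] := rw (Some i) I; apply.
    + by move=> i; have [_ _ +] := rw (Some i) I; apply.
    by move=> c ac; exists c.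
  - exact: regular_blocks_as.
have XV i k : same_law V (X (Some i, k.+1)) by have [_] := ev i; exact.
have law := queue_input_law mbl iX XV admitted iY
  (same_equilibrium_laws U_ge0 U_mean U_neq0 ea eu) _ pp.
pose num (z : pathspace R (nat + 'I_n + nat)) := number_in_system
  (fun k => z (inl (inl k))) (fun i => z (inl (inr i))) (fun k => z (inr k)) t.
have mnum : measurable_fun setT num.
  by apply: measurable_number_in_system => k; exact: measurable_coord.
have mS : measurable [set z | (x <= num z)%R].
  by apply/measurable_boolP; exact: measurable_fun_ler.
have -> : P1 [set w | (x <= Q t w)%R] = P1 (joint Y @^-1` [set z | (x <= num z)%R]) by [].
rewrite law//; last first.
  move=> i B mB; have [rv _] := ev i.
  rewrite /distribution /pushforward (residual_law V_ge0 V_mean V_neq0 (rr i) mB).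
  by rewrite (residual_law V_ge0 V_mean V_neq0 rv mB).
pose bound : set (pathspace R (option 'I_n * nat)) :=
  [set f | let c := forward (arrival_gaps f) (service_gaps f) in
    (x - eta%:R)%:E <= maxe 0 (excess c delta `[delta, t] eta) + idle c delta eta].
have mbound : measurable bound.
  rewrite -[X in measurable X]setTI; apply: emeasurable_fun_c_infty => //.
  apply: emeasurable_funD.
    apply: measurable_maxe; first exact: measurable_cst.
    apply: measurable_excess => //=.
    - by move=> k; exact: measurable_arrival_gaps.
    - by move=> i k; exact: measurable_service_gaps.
    - by rewrite in_itv/= lexx.
    - by move=> s; rewrite in_itv/= => /andP[].
    - by move=> s q; rewrite !in_itv/= => /andP[_ st] /andP[-> qs]; exact: le_trans st.
  by apply: measurable_idle => // [k|i k];
    [exact: measurable_arrival_gaps|exact: measurable_service_gaps].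
have mbw phi : measurable_fun setT phi -> measurable (joint X @^-1` (blockwise phi @^-1` bound)).
  move=> mphi; apply: mX; apply: measurable_preimageT => //.
  exact: measurable_blockwise.
have window s : `[0%R, delta]%classic s \/ `[delta, t]%classic s -> (0 <= s <= t)%R.
  move=> [] /=; rewrite in_itv/= => /andP[h1 h2].
    by rewrite h1 (le_trans h2).
  by rewrite h2 (le_trans dl0).
have ext c c' : (forall j s, (0 <= s <= t)%R -> c j s = c' j s) ->
    excess c delta `[delta, t] eta = excess c' delta `[delta, t] eta /\
    idle c delta eta = idle c' delta eta.
  move=> cc'; split; first by apply: excess_ext => // j s /window; exact: cc'.
  by apply: idle_ext => j; apply: cc'; rewrite dl0.
apply: (@le_trans _ _ (P2 (joint X @^-1` (blockwise (reversed t) @^-1` bound)))).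
  rewrite -(measure_eq1I _ (mX mreg) regular_blocks_as); last first.
    apply: (measurable_preimageT _ mS); apply: measurableT_comp.
      exact: measurable_queue_input.
    exact: measurable_joint.
  apply: le_measure; rewrite ?inE.
  - apply: measurableI; last exact: mX.
    apply: (measurable_preimageT _ mS); apply: measurableT_comp.
      exact: measurable_queue_input.
    exact: measurable_joint.
  - by apply: mbw; exact: measurable_reversed.
  move=> w [/= xnum rw]; pose f := joint X w.
  have reg c : regular (block f c) by exact: rw.
  have main := @number_in_system_le R n (arrival_gaps f) (service_gaps f)
    (recorded bl f) t delta eta n_gt0 en.
  rewrite /bound /=.
  set c := forward _ _.
  have [-> ->] : excess c delta `[delta, t] eta =
      excess (backward (arrival_gaps f) (service_gaps f) t) delta `[delta, t] eta /\
      idle c delta eta = idle (backward (arrival_gaps f) (service_gaps f) t) delta eta.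
    apply: ext => -[i|] s s0t.
      exact: (renewals_reversed t0 (reg (Some i)) s0t).
    exact: (renewals_reversed t0 (reg None) s0t).
  apply: (@le_trans _ _ ((num (queue_input bl f))%:E - eta%:R%:E)).
    by rewrite -EFinB lee_fin lerB.
  apply: main.
  - by rewrite dl0.
  - by have [] := reg None.
  - by move=> i; have [] := reg (Some i).
  - by have [] := reg None.
  - by move=> i; have [] := reg (Some i).
  - by move=> l k; exact: recordedE.
rewrite -reversible_blocks//.
rewrite -(measure_eq1I _ (mX mreg) regular_blocks_as); last first.
  by apply: mbw; exact: measurable_truncated.
apply: le_measure; rewrite ?inE.
- by apply: measurableI; [apply: mbw; exact: measurable_truncated|exact: mX].
- apply: mX; apply: measurable_exceeds => //=.
  + by rewrite in_itv/= lexx.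
  + by move=> s; rewrite in_itv/= => /andP[].
  + by move=> s q; rewrite !in_itv/= => /andP[_ st] /andP[-> qs]; exact: le_trans st.
move=> w [+ rw]; pose f := joint X w; rewrite /bound /exceeds /=.
set c := forward _ _ => bnd; set c' := forward _ _.
have [E1 E2] : excess c delta `[delta, t] eta = excess c' delta `[delta, t] eta /\
    idle c delta eta = idle c' delta eta.
  apply: ext => -[i|] s /andP[_ st].
    exact: (renewals_truncated t0 (rw (Some i) I) st).
  exact: (renewals_truncated t0 (rw None I) st).
by move: bnd; rewrite E1 E2 max_r// excess_ge0.
Qed.

End bound.

Theorem theorem4 (R : realType)
  (d0 : measure_display) (T0 : measurableType d0) (P0 : probability T0 R)
  (U V : {RV P0 >-> R})
  (n : nat)
  (d1 : measure_display) (T1 : measurableType d1) (P1 : probability T1 R)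
  (a : nat -> {RV P1 >-> R}) (r : 'I_n -> {RV P1 >-> R})
  (p : nat -> {RV P1 >-> R})
  (d2 : measure_display) (T2 : measurableType d2) (P2 : probability T2 R)
  (u : nat -> {RV P2 >-> R}) (v : 'I_n -> nat -> {RV P2 >-> R})
  (n_ge1 : (1 <= n)%N)
  (U_ge0 : forall w, (0 <= U w)%R) (V_ge0 : forall w, (0 <= V w)%R)
  (U_mean : P0.-integrable [set: T0] (EFin \o U))
  (V_mean : P0.-integrable [set: T0] (EFin \o V))
  (U_neq0 : P0 [set w | U w = 0%R] = 0) (V_neq0 : P0 [set w | V w = 0%R] = 0)
  (HQ : GI_GI_n_primitives U V a r p)
  (HAN : independent_equilibrium_renewals U V u v) :
  let Q (t : R) (w : T1) : R :=
    number_in_system (fun k => a k w) (fun i => r i w) (fun k => p k w) t in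
  let A (s : R) (w : T2) : \bar R := renewals (fun k => u k w) s in
  let N (i : 'I_n) (s : R) (w : T2) : \bar R := renewals (fun k => v i k w) s in
  (forall t x : R, (0 <= t)%R -> (0 <= x)%R ->
    P1 [set w | (x <= Q t w)%R] <=
    ereal_inf [set P2 [set w |
        maxe (ereal_sup [set A s w - \sum_(i < n | (i < eta)%N) N i s w
                        | s in `[0%R, delta]])
             (ereal_sup [set A s w - \sum_(i < n) N i s w
                        | s in `[delta, t]]
              + \sum_(i < n | (eta <= i)%N) N i delta w)
        + \sum_(i < n | (eta <= i)%N) ((N i delta w == 0)%E : nat)%:R%:E
        >= (x - eta%:R)%:E]
      | delta in `[0%R, t] & eta in [set m : nat | (m <= n)%N]]) /\
  (forall Qoo : probability R R,
    weakly_converges P1 Q Qoo ->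
    forall x : R, (0 <= x)%R ->
    Qoo [set y | (x <= y)%R] <=
    ereal_inf [set P2 [set w |
        maxe (ereal_sup [set A s w - \sum_(i < n | (i < eta)%N) N i s w
                        | s in `[0%R, delta]])
             (ereal_sup [set A s w - \sum_(i < n) N i s w
                        | s in `[delta, +oo[]
              + \sum_(i < n | (eta <= i)%N) N i delta w)
        + \sum_(i < n | (eta <= i)%N) ((N i delta w == 0)%E : nat)%:R%:E
        >= (x - eta%:R)%:E]
      | delta in `[0%R, +oo[ & eta in [set m : nat | (m <= n)%N]]).
Proof.
move=> Q A N.
have tail t x delta eta : (0 <= delta <= t)%R -> (eta <= n)%N ->
  P1 [set w | (x <= Q t w)%R] <=
  P2 (joint (fun j : option 'I_n * nat => if j.1 is Some i then v i j.2 else u j.2)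
    @^-1` exceeds delta `[delta, t] eta x).
  exact: (tail_bound U_ge0 V_ge0 U_mean V_mean U_neq0 V_neq0 HAN HQ n_ge1).
split=> [t x t0 x0|Qoo wQ x x0].
  apply/ereal_infP => _ [delta + [eta en <-]]; rewrite /= in_itv/= => dt.
  exact: tail.
apply/ereal_infP => _ [delta + [eta en <-]]; rewrite /= in_itv/= andbT => d0'.
apply: (weak_limit_tail (t0 := delta) _ _ x0 wQ).
- by move=> t; apply: measurable_number_in_system => k; exact: measurable_funP.
- by move=> t w; exact: number_in_system_nat.
move=> t dt; apply: (le_trans (tail t x delta eta _ en)); first by rewrite d0'.
apply: (@le_trans _ _ (P2 (joint (fun j : option 'I_n * nat =>
  if j.1 is Some i then v i j.2 else u j.2) @^-1` exceeds delta `[delta, +oo[ eta x))).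
  have mj (B : set (pathspace R (option 'I_n * nat))) : measurable B ->
      measurable (joint (fun j : option 'I_n * nat =>
        if j.1 is Some i then v i j.2 else u j.2) @^-1` B).
    by apply: measurable_preimageT; exact: measurable_joint.
  apply: le_measure; rewrite ?inE.
  - apply: mj; apply: measurable_exceeds => //=.
    + by rewrite in_itv/= lexx.
    + by move=> s; rewrite in_itv/= => /andP[].
    + by move=> s q; rewrite !in_itv/= => /andP[_ st] /andP[-> qs]; exact: le_trans st.
  - apply: mj; apply: measurable_exceeds => //=.
    + by rewrite in_itv/= lexx.
    + by move=> s; rewrite in_itv/= andbT.
    + by move=> s q _ /andP[dq _]; rewrite in_itv/= dq.
  move=> w; rewrite /exceeds /= => /le_trans; apply; rewrite leeD2r//.
  by apply: le_excess => s /=; rewrite !in_itv/= andbT => /andP[].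
by [].
Qed.
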